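(* Inside the essential spectrum there exist transversal directions of order $\geq 2$. That is, there exist a rigging $F$, a self-adjoint operator $H_0$ such that $F$ is $|H_0|^{1/2}$-compact, a semi-regular point $\lambda\in\sigma_{ess}(H_0)$ at which $H_0$ is resonant, and a regular direction $V$ at $H_0$ which is transversal to the resonance set $\mathcal R(\lambda)$ at $H_0$ and which has order at least $2$.
   Context: A rigging is a closed densely defined operator $F\colon\mathcal H\to\mathcal K$ between complex Hilbert spaces with trivial kernel and dense range. Let $\mathcal A_0=\{F^*JF: J=J^*\in\mathcal B(\mathcal K)\}$, with norm $\|F^*JF\|=\|J\|$; its elements are called directions. $H_0$ is a self-adjoint operator on $\mathcal H$ such that $F$ is $|H_0|^{1/2}$-compact, and $\mathcal A=H_0+\mathcal A_0$ (form sums). For $H\in\mathcal A$ and non-real $z$, $T_z(H)$ is the closure of $F(H-z)^{-1}F^*$, and $T_{\lambda+i0}(H)$ is the norm limit of $T_{\lambda+iy}(H)$ as $y\to0^+$, if it exists. $H\in\mathcal A$ is regular at $\lambda\in\mathbb R$ if $T_{\lambda+i0}(H)$ exists, and resonant at $\lambda$ otherwise. $\lambda$ is semi-regular if some $H\in\mathcal A$ is regular at $\lambda$. The resonance set is $\mathcal R(\lambda)=\{H\in\mathcal A: H\text{ is resonant at }\lambda\}$. A direction $V=F^*JF$ is regular at $H_0$ if $T_{\lambda+i0}(H_0+rV)$ exists for some $r\in\mathbb R$. For a regular direction $V$ at a resonant $H_0$ a vector $u\in\mathcal K$ is a resonance vector of order $k\ge1$ if $[1-rT_{\lambda+i0}(H_0+rV)J]^ku=0$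 and $[1-rT_{\lambda+i0}(H_0+rV)J]^{k-1}u\ne0$, where $r$ is any real number for which $T_{\lambda+i0}(H_0+rV)$ exists (the notion does not depend on $r$). The order of $V$ is the maximal order of its resonance vectors. A direction $V$ is tangent to $\mathcal R(\lambda)$ at $H_0\in\mathcal R(\lambda)$ if there is an analytic path $H(s)$, $s$ in an open real interval around some $s_0$, of operators in $\mathcal R(\lambda)$ with $H(s_0)=H_0$ and $H'(s_0)=V$ (analyticity and derivatives are with respect to the norm of $\mathcal A_0$). A direction which is not tangent is called transversal. *)

(* Defs.v *)
From HB Require Import structures.
From mathcomp Require Import all_boot all_order all_algebra.
From mathcomp Require Import complex.
From mathcomp Require Import all_classical all_reals all_analysis.

Set Implicit Arguments.
Unset Strict Implicit.
Unset Printing Implicit Defensive.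

Import Order.TTheory GRing.Theory Num.Theory.
Import numFieldNormedType.Exports.

Local Open Scope classical_set_scope.
Local Open Scope ring_scope.
Local Open Scope complex_scope.

(* [inner] is linear in its first argument, following [{dot U for theta}]. *)
Record hilbertType (R : realType) := HilbertType {
  hilbert_sort :> completeNormedModType R[i];
  inner : {dot hilbert_sort for @Num.conj R[i]};
  inner_norm : forall x, inner x x = `|x| ^+ 2
}.

Notation "'[ x , y ]" := (inner _ x y) : ring_scope.

(* A possibly unbounded operator from H to K is represented by its graph,
   a set of pairs (x, y) with y the value at x. For graphs, the relational
   composition [(A \; B)%relation] is the operator product A B (apply B
   first, on the natural domain), and [(A^-1)%relation] is the inverse. *)
Definition linear_op (R : realType) (H K : hilbertType R) (G : set (H * K)) :=
  [/\ G (0, 0),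
      forall (a : R[i]) p q, G p -> G q -> G (a *: p + q) &
      forall y, G (0, y) -> y = 0].

Definition op_dom (R : realType) (H K : hilbertType R) (G : set (H * K)) :
  set H := [set x | exists y, G (x, y)].

Definition op_ran (R : realType) (H K : hilbertType R) (G : set (H * K)) :
  set K := [set y | exists x, G (x, y)].

Definition op_ker (R : realType) (H K : hilbertType R) (G : set (H * K)) :
  set H := [set x | G (x, 0)].

Definition op_adj (R : realType) (H K : hilbertType R) (G : set (H * K)) :
  set (K * H) :=
  [set q | forall x y, G (x, y) -> '[y, q.1] = '[x, q.2]].

(* The graph of G - z. *)
Definition op_shift (R : realType) (H : hilbertType R) (G : set (H * H))
    (z : R[i]) : set (H * H) :=
  [set p | exists2 y, G (p.1, y) & p.2 = y - z *: p.1].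

Definition graph_of (R : realType) (H K : hilbertType R) (T : H -> K) :
  set (H * K) := [set p | p.2 = T p.1].

Definition self_adjoint (R : realType) (H : hilbertType R) (G : set (H * H)) :=
  [/\ linear_op G, dense (op_dom G) & op_adj G = G].

Definition nonneg_op (R : realType) (H : hilbertType R) (G : set (H * H)) :=
  forall x y, G (x, y) -> 0 <= '[y, x].

(* The unique nonnegative self-adjoint square root, for A nonnegative
   self-adjoint. *)
Definition op_sqrt (R : realType) (H : hilbertType R) (A : set (H * H)) :
  set (H * H) :=
  get [set S : set (H * H) |
    [/\ self_adjoint S, nonneg_op S & (S \; S)%relation = A]].

Definition op_abs (R : realType) (H : hilbertType R) (G : set (H * H)) :
  set (H * H) := op_sqrt (op_adj G \; G)%relation.

(* The partial isometry of the polar decomposition G = sgn(G) |G|: it maps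
   |G| x to G x, vanishes on ker G, and is extended by continuity. *)
Definition op_sgn (R : realType) (H : hilbertType R) (G : set (H * H)) :
  set (H * H) :=
  closure [set p | exists x u k,
    [/\ op_abs G (x, u), G (x, p.2), op_ker G k & p.1 = u + k]].

Definition bounded_op (R : realType) (H K : hilbertType R) (T : H -> K) :=
  linear T /\ continuous T.

Definition bounded_sa (R : realType) (K : hilbertType R) (J : K -> K) :=
  bounded_op J /\ forall x y, '[J x, y] = '[x, J y].

(* Convergence T_i --> T0 in operator norm along the filter G. *)
Definition norm_cvg (R : realType) (K : hilbertType R) (I : Type)
    (G : set_system I) (T : I -> K -> K) (T0 : K -> K) :=
  forall e : R, 0 < e ->
    \forall i \near G, forall x, `|T i x - T0 x| <= e%:C * `|x|.

Definition spectrum (R : realType) (H : hilbertType R) (G : set (H * H)) :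
  set R[i] :=
  [set z | ~ exists T : H -> H,
    bounded_op T /\ graph_of T = ((op_shift G z)^-1)%relation].

(* Isolated eigenvalues of finite multiplicity. *)
Definition discrete_spectrum (R : realType) (H : hilbertType R)
    (G : set (H * H)) : set R[i] :=
  [set z | [/\ isolated (spectrum G : set R[i]^o) z,
    exists2 x, x != 0 & op_ker (op_shift G z) x &
    exists (n : nat) (b : 'I_n -> H), forall x, op_ker (op_shift G z) x ->
      exists c : 'I_n -> R[i], x = \sum_(i < n) c i *: b i]].

Definition essential_spectrum (R : realType) (H : hilbertType R)
    (G : set (H * H)) : set R[i] :=
  spectrum G `\` discrete_spectrum G.

Definition rigging (R : realType) (H K : hilbertType R) (F : set (H * K)) :=
  [/\ linear_op F, closed F, dense (op_dom F),
      op_ker F = [set 0] & dense (op_ran F)].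

(* F is S-compact: compact on dom S with the graph norm of S. *)
Definition rel_compact (R : realType) (H K : hilbertType R)
    (S : set (H * H)) (F : set (H * K)) :=
  op_dom S `<=` op_dom F /\
  compact (closure [set y | exists x w,
    [/\ S (x, w), `|x| <= 1, `|w| <= 1 & F (x, y)]]).

(* The form sum H0 + F^*JF: the operator associated with the form
     (f, g) |-> <sgn(H0) |H0|^(1/2) g, |H0|^(1/2) f> + <J F g, F f>
   on dom |H0|^(1/2). No semiboundedness of H0 is required. *)
Definition form_sum (R : realType) (H K : hilbertType R) (F : set (H * K))
    (H0 : set (H * H)) (J : K -> K) : set (H * H) :=
  let S := op_sqrt (op_abs H0) in
  [set p | exists sg ug Fg,
    [/\ S (p.1, sg), op_sgn H0 (sg, ug), F (p.1, Fg) &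
        forall f sf Ff, S (f, sf) -> F (f, Ff) ->
          '[ug, sf] + '[J Fg, Ff] = '[p.2, f]]].

(* A direction F^*JF is represented by J, which it determines since F has
   dense range, and the norm of F^*JF is by definition that of J. *)
Definition affine_space (R : realType) (H K : hilbertType R)
    (F : set (H * K)) (H0 : set (H * H)) : set (set (H * H)) :=
  [set G | exists2 J : K -> K, bounded_sa J & G = form_sum F H0 J].

(* The graph of T_z(G), the closure of F (G - z)^-1 F^*. *)
Definition sandwiched_resolvent (R : realType) (H K : hilbertType R)
    (F : set (H * K)) (G : set (H * H)) (z : R[i]) : set (K * K) :=
  closure (F \; ((op_shift G z)^-1 \; op_adj F))%relation.

(* T = T_{lam + i0}(G). *)
Definition is_boundary_value (R : realType) (H K : hilbertType R)
    (F : set (H * K)) (G : set (H * H)) (lam : R) (T : K -> K) :=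
  bounded_op T /\
  exists Ty : R -> K -> K,
    (forall y, 0 < y -> bounded_op (Ty y) /\
       graph_of (Ty y) = sandwiched_resolvent F G (lam +i* y)) /\
    norm_cvg 0^'+ Ty T.

Definition regular_at (R : realType) (H K : hilbertType R)
    (F : set (H * K)) (lam : R) (G : set (H * H)) :=
  exists T : K -> K, is_boundary_value F G lam T.

Definition semi_regular (R : realType) (H K : hilbertType R)
    (F : set (H * K)) (H0 : set (H * H)) (lam : R) :=
  exists2 G, affine_space F H0 G & regular_at F lam G.

Definition resonance_set (R : realType) (H K : hilbertType R)
    (F : set (H * K)) (H0 : set (H * H)) (lam : R) : set (set (H * H)) :=
  [set G | affine_space F H0 G /\ ~ regular_at F lam G].

Definition path_along (R : realType) (H K : hilbertType R)
    (F : set (H * K)) (H0 : set (H * H)) (J : K -> K) (r : R) : set (H * H) :=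
  form_sum F H0 (fun x => r%:C *: J x).

Definition regular_direction (R : realType) (H K : hilbertType R)
    (F : set (H * K)) (H0 : set (H * H)) (lam : R) (J : K -> K) :=
  bounded_sa J /\ exists r : R, regular_at F lam (path_along F H0 J r).

Definition resonance_vector (R : realType) (H K : hilbertType R)
    (F : set (H * K)) (H0 : set (H * H)) (lam : R) (J : K -> K)
    (k : nat) (u : K) :=
  (1 <= k)%N /\
  exists (r : R) (T : K -> K),
    is_boundary_value F (path_along F H0 J r) lam T /\
    let A v := v - r%:C *: T (J v) in
    iter k A u = 0 /\ iter k.-1 A u != 0.

Definition direction_order (R : realType) (H K : hilbertType R)
    (F : set (H * K)) (H0 : set (H * H)) (lam : R) (J : K -> K) (d : nat) :=
  (exists u, resonance_vector F H0 lam J d u) /\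
  forall k u, resonance_vector F H0 lam J k u -> (k <= d)%N.

(* Real-analyticity on ]a, b[, in operator norm, of a path of bounded
   self-adjoint operators. *)
Definition analytic_path (R : realType) (K : hilbertType R) (a b : R)
    (J : R -> K -> K) :=
  (forall s, a < s < b -> bounded_sa (J s)) /\
  forall s1, a < s1 < b ->
    exists (c : nat -> K -> K) (rho : R),
      [/\ forall n, bounded_sa (c n), 0 < rho &
          forall s, a < s < b -> `|s - s1| < rho ->
            norm_cvg \oo
              (fun n x => \sum_(k < n) ((s - s1) ^+ k)%:C *: c k x) (J s)].

Definition tangent_direction (R : realType) (H K : hilbertType R)
    (F : set (H * K)) (H0 : set (H * H)) (lam : R) (J : K -> K) :=
  exists (a b s0 : R) (Js : R -> K -> K),
    [/\ a < s0 < b, analytic_path a b Js,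
        forall s, a < s < b -> resonance_set F H0 lam (form_sum F H0 (Js s)),
        form_sum F H0 (Js s0) = H0 &
        norm_cvg 0^'
          (fun (h : R) x => (h^-1)%:C *: (Js (s0 + h) x - Js s0 x)) J].

Definition transversal_direction (R : realType) (H K : hilbertType R)
    (F : set (H * K)) (H0 : set (H * H)) (lam : R) (J : K -> K) :=
  ~ tangent_direction F H0 lam J.

(* Main.v *)
Require Import Defs.
From HB Require Import structures.
From mathcomp Require Import all_boot all_order all_algebra.
From mathcomp Require Import complex ring lra.
From mathcomp Require Import all_classical all_reals all_analysis.

(** The example is built on the space of square-summable sequences, taken as
    both [H] and [K], at [lam = 2].

    Let [p 0 = 1] and let [p 1, p 2, ...] be [1, -1, 1/2, -1/2, 1/3, ...], and
    let [phi] be the vector with [phi 0 = 0] and [phi n = |p n|] for [n > 0].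
    The rigging is [F x = (<x, phi>, p 0 ^ 2 x 0, p 1 ^ 2 x 1, ...)], a bounded
    injective operator with dense range, compact because its values on the unit
    ball lie in a Hilbert cube. The operators are [H0 = diag (2, 2 + p 1, 2 + p 2, ...)]
    and [H1 = H0 + F^* Jreg F = diag (2 + p 0, 2 + p 1, ...)], where [Jreg] is the
    projection onto the basis vector [e1] of [K]. Thus 2 is an eigenvalue of [H0]
    and a limit of other eigenvalues, hence a point of the essential spectrum.

    As [y -> 0+], [T_{2+iy}(H1)] has a norm limit [T] ([Tref_cvg]). The only
    delicate entry is the first one, [sum_(n > 0) p n ^ 2 / (p n - iy)]: its real part
    cancels by symmetry, while its imaginary part is twice the Riemann sum
    [sum_k y / (1 + k^2 y^2)], compared with [atan] ([phi_rpts_limit]); its limit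
    is [i pi]. All other entries have real limits, so that the imaginary part of
    [T] is [pi] times the projection onto the basis vector [e0] ([Tlim_im]): this
    is where the accumulation of the spectrum at 2 enters.

    For every direction [J] the second resolvent identity gives
    [(1 + T_z(H1) (J - Jreg)) T_z(H0 + F^*JF) = T_z(H1)]. Hence [H0 + F^*JF] is
    regular at 2 as soon as [1 + T (J - Jreg)] is bounded below
    ([regular_of_lower_bound]), and each boundary value satisfies the limit
    identity ([boundary_identity]).

    The direction is [V], exchanging [e0] and [e1]. If [J] is within [eps |h|] of
    [h V], with [h <> 0] small, then [1 + T (J - Jreg)] is bounded below
    ([lower_bound]). Indeed for a vector [u] of its kernel and [x = (J - Jreg) u],
    the number [<T x, x> = - <u, x>] is real, so that [x 0 = 0]; but [x 0] is
    nearly [h * u 1], so that [u 1], then [x], then [u = - T x] are small compared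
    with [u]. Consequently [V] is a regular direction, and it is transversal: a
    path through [H0] with derivative [V] consists of regular operators near
    [H0], except for [H0] itself.

    Finally, if [T_r] is the boundary value at [H0 + r F^*VF], then [r <> 0] and
    the limit identity determines [A = 1 - r T_r V] on coordinates ([A_step]).
    It yields [A^3 = A^2], while [u = T e0] satisfies [A^2 u = 0] and [A u <> 0].
    So the order of [V] is 2. *)

Set Implicit Arguments.
Unset Strict Implicit.
Unset Printing Implicit Defensive.

Import Order.TTheory GRing.Theory Num.Theory.
Import numFieldNormedType.Exports.

Local Open Scope classical_set_scope.
Local Open Scope ring_scope.
Local Open Scope complex_scope.

(* The real-valued parts of [R[i]], not those of closed fields. *)
Local Notation re := (@complex.Re _).
Local Notation im := (@complex.Im _).

(** * Real-valued norms, moduli and sesquilinear forms *)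

Section RealNorm.
Variables (R : realType) (V : normedModType R[i]).
Implicit Types x y : V.

(** The norm as a real number: that of a normed module over [R[i]] is a
    nonnegative element of [R[i]]. *)
Definition rnorm (x : V) : R := re `|x|.

Lemma normr_rnorm x : `|x| = (rnorm x)%:C.
Proof. by rewrite /rnorm RRe_real // normr_real. Qed.

Lemma rnorm_ge0 x : 0 <= rnorm x.
Proof. by rewrite -ler0c -normr_rnorm. Qed.

Lemma rnorm0 : rnorm 0 = 0.
Proof. by apply: complexI; rewrite -normr_rnorm normr0. Qed.

Lemma rnorm0_eq0 x : rnorm x = 0 -> x = 0.
Proof. by move=> x0; apply/eqP; rewrite -normr_eq0 normr_rnorm x0. Qed.

Lemma rnormD x y : rnorm (x + y) <= rnorm x + rnorm y.
Proof. by rewrite -lecR rmorphD /= -!normr_rnorm ler_normD. Qed.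

Lemma rnormN x : rnorm (- x) = rnorm x.
Proof. by apply: complexI; rewrite -!normr_rnorm normrN. Qed.

Lemma rnormB x y : rnorm (x - y) <= rnorm x + rnorm y.
Proof. by rewrite (le_trans (rnormD _ _)) // rnormN. Qed.

Lemma rnormZr (a : R) x : rnorm (a%:C *: x) = `|a| * rnorm x.
Proof.
apply: complexI; rewrite rmorphM /= -!normr_rnorm normrZ.
by rewrite normc_def /= expr0n /= addr0 sqrtr_sqr.
Qed.

Lemma rnorm_lt x (e : R) : (`|x| < e%:C) = (rnorm x < e).
Proof. by rewrite normr_rnorm ltcR. Qed.

Lemma rnorm_le x (e : R) : (`|x| <= e%:C) = (rnorm x <= e).
Proof. by rewrite normr_rnorm lecR. Qed.

(** Neighbourhoods and limits through the real-valued norm. *)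
Lemma rnorm_nbhsP (x : V) (A : set V) :
  nbhs x A <-> exists2 e : R, 0 < e & forall y, rnorm (x - y) < e -> A y.
Proof.
split.
  move=> /nbhs_ballP[e e0 eA].
  have eR : (re e)%:C = e by rewrite RRe_real // gtr0_real.
  exists (re e); first by rewrite -ltcR eR.
  by move=> y xy; apply: eA; rewrite -ball_normE /= -eR rnorm_lt.
move=> [e e0 eA]; apply/nbhs_ballP; exists e%:C; first by rewrite /= ltcR.
by move=> y; rewrite -ball_normE /= rnorm_lt => /eA.
Qed.

Lemma rnorm_cvgP T (F : set_system T) {FF : Filter F} (f : T -> V) (l : V) :
  f @ F --> l <-> forall e : R, 0 < e -> \forall t \near F, rnorm (l - f t) < e.
Proof.
split.
  move=> fl e e0; have /(fl _) : nbhs l [set y | rnorm (l - y) < e].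
    by apply/rnorm_nbhsP; exists e.
  by [].
move=> fe A /rnorm_nbhsP[e e0 eA]; apply: filterS (fe e e0) => t; exact: eA.
Qed.

Lemma rnorm_cauchyP (F : set_system V) {FF : ProperFilter F} :
  cauchy F <-> forall e : R, 0 < e ->
    exists2 A, F A & forall x y, A x -> A y -> rnorm (x - y) < e.
Proof.
split.
  move=> /cauchy_ballP cF e e0.
  have e2c : (0 : R[i]) < (e / 2)%:C by rewrite ltcR divr_gt0.
  have [[P Q] /= [FP FQ] PQ] := cF _ e2c.
  have [z [Pz Qz]] := filter_ex (filterI FP FQ).
  exists Q => // x y Qx Qy.
  have := PQ (z, x) (conj Pz Qx); have := PQ (z, y) (conj Pz Qy).
  rewrite -!ball_normE /= !rnorm_lt => zy zx.
  rewrite (splitr e) (_ : x - y = (z - y) - (z - x)); last first.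
    by rewrite opprB [RHS]addrC addrA subrK.
  by rewrite (le_lt_trans (rnormB _ _)) // ltrD.
move=> h; apply/cauchy_ballP => e e0.
have eR : (re e)%:C = e by rewrite RRe_real // gtr0_real.
have e0' : 0 < re e by rewrite -ltcR eR.
have [A FA Ae] := h _ e0'.
by exists (A, A) => // -[x y] [/= Ax Ay]; rewrite -ball_normE /= -eR rnorm_lt; exact: Ae.
Qed.
End RealNorm.

Section Modulus.
Variable R : realType.
Implicit Types z w : R[i].

(** The modulus as a real number. *)
Definition cmod (z : R[i]) : R := re `|z|.

Lemma normr_cmod z : `|z| = (cmod z)%:C.
Proof. by rewrite /cmod RRe_real // normr_real. Qed.

Lemma cmod_sqr z : cmod z ^+ 2 = re z ^+ 2 + im z ^+ 2.
Proof. by apply: complexI; rewrite rmorphXn /= -normr_cmod add_Re2_Im2. Qed.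

Lemma cmod_ge0 z : 0 <= cmod z.
Proof. by rewrite -ler0c -normr_cmod. Qed.

Lemma cmodM z w : cmod (z * w) = cmod z * cmod w.
Proof. by apply: complexI; rewrite rmorphM /= -!normr_cmod normrM. Qed.

Lemma cmodJ z : cmod (conjc z) = cmod z.
Proof. by apply: complexI; rewrite -!normr_cmod normcJ. Qed.

Lemma cmodR (a : R) : cmod a%:C = `|a|.
Proof. by rewrite /cmod normc_def /= expr0n addr0 sqrtr_sqr. Qed.

Lemma cmodV z : cmod z^-1 = (cmod z)^-1.
Proof. by apply: complexI; rewrite fmorphV /= -!normr_cmod normfV. Qed.

Lemma cmodD z w : cmod (z + w) <= cmod z + cmod w.
Proof. by rewrite -lecR rmorphD /= -!normr_cmod ler_normD. Qed.

Lemma cmodN z : cmod (- z) = cmod z.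
Proof. by rewrite /cmod normrN. Qed.

Lemma normr_re_le z : `|re z| <= cmod z.
Proof.
rewrite -(ler_pXn2r (n := 2)) ?nnegrE ?normr_ge0 ?cmod_ge0 //.
by rewrite cmod_sqr real_normK ?num_real // lerDl sqr_ge0.
Qed.

Lemma normr_im_le z : `|im z| <= cmod z.
Proof.
rewrite -(ler_pXn2r (n := 2)) ?nnegrE ?normr_ge0 ?cmod_ge0 //.
by rewrite cmod_sqr real_normK ?num_real // lerDr sqr_ge0.
Qed.

Lemma cmod_dist z w : `|cmod z - cmod w| <= cmod (z - w).
Proof.
have := cmodD (z - w) w; have := cmodD (w - z) z.
by rewrite !subrK -(cmodN (w - z)) opprB ler_norml => h1 h2; apply/andP; split; lra.
Qed.

Lemma reD z w : re (z + w) = re z + re w. Proof. by case: z; case: w. Qed.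
Lemma imD z w : im (z + w) = im z + im w. Proof. by case: z; case: w. Qed.
Lemma reN z : re (- z) = - re z. Proof. by case: z. Qed.
Lemma imN z : im (- z) = - im z. Proof. by case: z. Qed.
Lemma reM z w : re (z * w) = re z * re w - im z * im w.
Proof. by case: z; case: w. Qed.
Lemma imM z w : im (z * w) = re z * im w + im z * re w.
Proof. by case: z; case: w. Qed.
Lemma reJ z : re (conjc z) = re z. Proof. by case: z. Qed.
Lemma imJ z : im (conjc z) = - im z. Proof. by case: z. Qed.
Lemma complexP z w : re z = re w -> im z = im w -> z = w.
Proof. by case: z; case: w => ? ? ? ? /= -> ->. Qed.
Lemma conjcM z w : conjc (z * w) = conjc z * conjc w.
Proof. exact: rmorphM. Qed.
Lemma conjcN z : conjc (- z) = - conjc z.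
Proof. exact: rmorphN. Qed.
End Modulus.

Section LinearMaps.
Variables (R : realType) (V W : normedModType R[i]) (T : V -> W).
Hypothesis T_lin : linear T.

Let T' : {linear V -> W} := HB.pack T (GRing.isLinear.Build _ _ _ _ T T_lin).

Lemma lin0 : T 0 = 0. Proof. exact: (linear0 T'). Qed.
Lemma linD x y : T (x + y) = T x + T y. Proof. exact: (linearD T'). Qed.
Lemma linB x y : T (x - y) = T x - T y. Proof. exact: (linearB T'). Qed.
Lemma linZ a x : T (a *: x) = a *: T x. Proof. exact: (linearZ_LR T'). Qed.

(** Continuous linear maps are the bounded ones. *)
Lemma lin_continuousP :
  continuous T <-> exists2 M : R, 0 <= M & forall x, rnorm (T x) <= M * rnorm x.
Proof.
split.
  move=> /(_ 0) /rnorm_cvgP; rewrite lin0 => /(_ 1 ltr01).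
  move=> /rnorm_nbhsP[e e0 eT]; exists (2 / e); first by rewrite divr_ge0 // ltW.
  move=> x; have [->|x0] := eqVneq x 0; first by rewrite lin0 !rnorm0 mulr0.
  have nx : 0 < rnorm x.
    rewrite lt_neqAle rnorm_ge0 andbT; apply: contraNneq x0 => /esym h.
    by apply/eqP; exact: rnorm0_eq0.
  pose c : R := e / 2 / rnorm x.
  have c0 : 0 < c by rewrite !divr_gt0.
  have := eT (c%:C *: x); rewrite !sub0r !rnormN linZ !rnormZr gtr0_norm //.
  rewrite {1}/c divfK ?gt_eqF // ltr_pdivrMr // ltr_pMr // ltr1n => /(_ isT) h.
  have := ltW h; rewrite mulrC -ler_pdivlMr // => /le_trans; apply.
  by rewrite /c div1r !invfM !invrK -mulrA mulrCA -mulrA (mulrC _ (rnorm x)).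
move=> [M M0 bM] x; apply/rnorm_cvgP => e e0; apply/rnorm_nbhsP.
exists (e / (M + 1)); first by rewrite divr_gt0 // ltr_wpDl.
move=> y; rewrite ltr_pdivlMr ?ltr_wpDl // -linB => h.
rewrite (le_lt_trans (bM _)) // (le_lt_trans _ h) // mulrC.
by rewrite ler_wpM2l ?rnorm_ge0 // lerDl ler01.
Qed.
End LinearMaps.

Section DotForm.
Variables (R : realType) (U : lmodType R[i]) (form : {dot U for @Num.conj R[i]}).
Implicit Types x y z : U.

Lemma formDl x y z : form (x + y) z = form x z + form y z.
Proof. exact: linearDl. Qed.
Lemma formZl a x z : form (a *: x) z = a * form x z.
Proof. exact: linearZl_LR. Qed.
Lemma formC x y : form x y = conjc (form y x).
Proof. by rewrite hermC /= expr0 mul1r. Qed.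
Lemma formDr x y z : form x (y + z) = form x y + form x z.
Proof. by rewrite formC formDl rmorphD /= -!formC. Qed.
Lemma formZr a x z : form x (a *: z) = conjc a * form x z.
Proof. by rewrite formC formZl rmorphM /= -!formC. Qed.

Lemma form_real x : form x x = (re (form x x))%:C.
Proof. by rewrite RRe_real // ger0_real // dnorm_ge0. Qed.

Lemma formD_sqr x y : re (form (x + y) (x + y)) =
  re (form x x) + 2 * re (form x y) + re (form y y).
Proof. by rewrite formDl !formDr !reD (formC y x) reJ; ring. Qed.

Lemma form_cauchy_schwarz x y :
  cmod (form x y) ^+ 2 <= re (form x x) * re (form y y).
Proof.
have [->|y0] := eqVneq y 0.
  have z0 : form x 0 = 0 by rewrite -(scale0r 0) formZr rmorph0 mul0r.
  have z1 : form 0 0 = 0 :> R[i] by rewrite -(scale0r 0) formZl mul0r.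
  by rewrite z0 z1 /cmod normr0 mulr0 expr0n.
have ny : 0 < re (form y y) by rewrite -ltcR -form_real dnorm_gt0.
pose a : R[i] := - form x y / (re (form y y))%:C.
have a_re : re (form x (a *: y)) = - cmod (form x y) ^+ 2 / re (form y y).
  rewrite formZr; have -> : conjc a = - conjc (form x y) / (re (form y y))%:C.
    by rewrite /a conjcM conjcN conjc_inv conjc_real.
  suff -> : - conjc (form x y) / (re (form y y))%:C * form x y =
     (- cmod (form x y) ^+ 2 / re (form y y))%:C by [].
  rewrite mulrAC mulNr (mulrC (conjc _)) -sqr_normc normr_cmod.
  by rewrite [RHS]rmorphM [in RHS]rmorphN /= fmorphV [in RHS]rmorphXn.
have a_n : re (form (a *: y) (a *: y)) = cmod (form x y) ^+ 2 / re (form y y).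
  rewrite formZl formZr mulrA -sqr_normc form_real.
  rewrite normr_cmod -rmorphXn -rmorphM /= /a cmodM cmodN cmodV cmodR.
  rewrite gtr0_norm // exprMn exprVn.
  move: ny; move: (re (form y y)) => n n0.
  by rewrite [n ^+ 2]expr2 invfM mulrA divfK ?gt_eqF.
have : 0 <= re (form (x + a *: y) (x + a *: y)).
  by rewrite -ler0c -form_real dnorm_ge0.
rewrite formD_sqr a_re a_n mulNr mulrN addrAC -addrA.
have -> (t : R) : t - 2 * t = - t by ring.
by rewrite subr_ge0 ler_pdivrMr.
Qed.
End DotForm.

Section HilbertGeometry.
Variables (R : realType) (H : hilbertType R).
Implicit Types x y z : H.

Lemma innerDl x y z : '[x + y, z] = '[x, z] + '[y, z].
Proof. exact: formDl. Qed.
Lemma innerZl a x z : '[a *: x, z] = a * '[x, z].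
Proof. exact: formZl. Qed.
Lemma innerC x y : '[x, y] = conjc '[y, x].
Proof. exact: formC. Qed.
Lemma innerDr x y z : '[x, y + z] = '[x, y] + '[x, z].
Proof. exact: formDr. Qed.
Lemma innerZr a x z : '[x, a *: z] = conjc a * '[x, z].
Proof. exact: formZr. Qed.
Lemma inner0l x : '[0, x] = 0.
Proof. by rewrite -(scale0r 0) innerZl mul0r. Qed.
Lemma inner0r x : '[x, 0] = 0.
Proof. by rewrite innerC inner0l rmorph0. Qed.
Lemma innerNl x z : '[- x, z] = - '[x, z].
Proof. by rewrite -scaleN1r innerZl mulN1r. Qed.
Lemma innerNr x z : '[x, - z] = - '[x, z].
Proof. by rewrite innerC innerNl rmorphN /= -innerC. Qed.
Lemma innerBl x y z : '[x - y, z] = '[x, z] - '[y, z].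
Proof. by rewrite innerDl innerNl. Qed.
Lemma innerBr x y z : '[x, y - z] = '[x, y] - '[x, z].
Proof. by rewrite innerDr innerNr. Qed.

Lemma inner_rnorm x : '[x, x] = (rnorm x ^+ 2)%:C.
Proof. by rewrite inner_norm normr_rnorm rmorphXn. Qed.

Lemma inner_eq0 x : '[x, x] = 0 -> x = 0.
Proof.
rewrite inner_rnorm => /complexI/eqP; rewrite sqrf_eq0 => /eqP; exact: rnorm0_eq0.
Qed.

Lemma inner_eq x y : (forall z, '[x, z] = '[y, z]) -> x = y.
Proof.
move=> h; apply/eqP; rewrite -subr_eq0; apply/eqP/inner_eq0.
by rewrite innerBl h subrr.
Qed.

Lemma rnormD_sqr x y :
  rnorm (x + y) ^+ 2 = rnorm x ^+ 2 + 2 * re '[x, y] + rnorm y ^+ 2.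
Proof. by have := formD_sqr (inner H) x y; rewrite !inner_rnorm. Qed.

Lemma cauchy_schwarz x y : cmod '[x, y] <= rnorm x * rnorm y.
Proof.
rewrite -(ler_pXn2r (n := 2)) ?nnegrE ?cmod_ge0 ?mulr_ge0 ?rnorm_ge0 //.
by rewrite exprMn (le_trans (form_cauchy_schwarz _ _ _)) // !inner_rnorm.
Qed.
End HilbertGeometry.

(** * Bounded operators and their norm limits *)

Section BoundedOperators.
Variables (R : realType) (H K : hilbertType R).

Lemma bounded_opP (T : H -> K) : bounded_op T <->
  linear T /\ exists2 M : R, 0 <= M & forall x, rnorm (T x) <= M * rnorm x.
Proof. by split=> -[Tl Tb]; split=> //; apply/(lin_continuousP Tl). Qed.

Lemma closed_graph (T : H -> K) : bounded_op T -> closed (graph_of T).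
Proof.
move=> /bounded_opP[Tl [M M0 bM]] [x y] cxy.
apply/eqP; rewrite -subr_eq0; apply/eqP/rnorm0_eq0/eqP => /=.
rewrite eq_le rnorm_ge0 andbT; apply/ler_addgt0Pr => e e0; rewrite add0r.
pose d := e / (M + 1); have d0 : 0 < d by rewrite divr_gt0 // ltr_wpDl.
have [] := cxy [set p | rnorm (x - p.1) < d /\ rnorm (y - p.2) < d].
  exists ([set u | rnorm (x - u) < d], [set v | rnorm (y - v) < d]) => //=.
  by split; apply/rnorm_nbhsP; exists d.
move=> [u v] [/= gT [xu yv]].
have -> : y - T x = (y - v) - T (x - u) by rewrite (linB Tl) -gT opprB addrA subrK.
rewrite (le_trans (rnormB _ _)) // (le_trans (lerD (ltW yv) (bM _))) //.
rewrite (le_trans (lerD (lexx _) (ler_wpM2l M0 (ltW xu)))) //.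
by rewrite -[X in X + _]mul1r -mulrDl addrC /d mulrC divfK // gt_eqF // ltr_wpDl.
Qed.

Lemma norm_cvg_at0P (I : R -> K -> K) (T0 : K -> K) : norm_cvg 0^'+ I T0 <->
  forall e : R, 0 < e -> exists2 d : R, 0 < d & forall y, 0 < y < d ->
    forall x, rnorm (I y x - T0 x) <= e * rnorm x.
Proof.
split=> h e e0.
  have [d /= d0 dh] := h e e0; exists d => // y /andP[y0 yd] x.
  have := dh y; rewrite /= sub0r normrN gtr0_norm // => /(_ yd y0 x).
  by rewrite !normr_rnorm -rmorphM lecR.
have [d d0 dh] := h e e0; exists d => //= y.
rewrite /= sub0r normrN => yd y0 x; rewrite !normr_rnorm -rmorphM lecR dh //.
by rewrite y0 (le_lt_trans (ler_norm _)).
Qed.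
End BoundedOperators.

Section Limits.
Variables (R : realType) (K : hilbertType R).
Implicit Types (T S : R -> K -> K).

(** Completeness of the bounded operators, for families indexed by [y > 0]. *)
Lemma op_cauchy_cvg T : (forall y, 0 < y -> bounded_op (T y)) ->
  (forall e : R, 0 < e -> exists2 d : R, 0 < d & forall y y', 0 < y < d -> 0 < y' < d ->
     forall x, rnorm (T y x - T y' x) <= e * rnorm x) ->
  exists2 T0 : K -> K, bounded_op T0 & norm_cvg 0^'+ T T0.
Proof.
move=> Tb Tc.
have ex x : exists l : K, T y x @[y --> 0^'+] --> l.
  suff : cvg (T y x @[y --> 0^'+]) by move=> ?; exists (lim (T y x @[y --> 0^'+])).
  apply: cauchy_cvg; apply/rnorm_cauchyP => e e0.
  pose e' := e / 2 / (rnorm x + 1).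
  have x1 : 0 < rnorm x + 1 by rewrite ltr_wpDl // rnorm_ge0.
  have e'0 : 0 < e' by rewrite !divr_gt0.
  have [d d0 dT] := Tc _ e'0.
  exists [set z | exists2 y, 0 < y < d & z = T y x].
    exists d => //= y; rewrite /= sub0r normrN => yd y0; exists y => //.
    by rewrite y0 (le_lt_trans (ler_norm _)).
  move=> _ _ [y yd ->] [y' yd' ->]; rewrite (le_lt_trans (dT _ _ yd yd' x)) //.
  rewrite (@le_lt_trans _ _ (e / 2)) ?ltr_pdivrMr ?ltr_pMr ?ltr1n //.
  rewrite /e' mulrAC ler_pdivrMr // ler_wpM2l ?lerDl ?ler01 //.
  by rewrite divr_ge0 // ltW.
have [T0 T0P] := choice ex.
have T0c (e : R) : 0 < e -> exists2 d : R, 0 < d & forall y, 0 < y < d ->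
    forall x, rnorm (T y x - T0 x) <= e * rnorm x.
  move=> e0; have [d d0 dT] := Tc _ e0; exists d => // y yd x.
  apply/ler_addgt0Pr => f f0.
  have /rnorm_cvgP /(_ f f0)[d' /= d'0 d'T] := T0P x.
  pose y' := Num.min d d' / 2.
  have md : 0 < Num.min d d' by rewrite lt_min d0.
  have y'0 : 0 < y' by rewrite divr_gt0.
  have y'm : y' < Num.min d d' by rewrite ltr_pdivrMr // ltr_pMr // ltr1n.
  move: (y'm); rewrite lt_min => /andP[y'd y'd'].
  have := d'T y'; rewrite /= sub0r normrN gtr0_norm // => /(_ y'd' y'0) h.
  have -> : T y x - T0 x = (T y x - T y' x) - (T0 x - T y' x) by rewrite opprB addrA subrK.
  rewrite (le_trans (rnormB _ _)) // lerD ?(ltW h) // dT // ?y'0 //.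
exists T0; last by apply/norm_cvg_at0P.
have T0l : linear T0.
  move=> a u v; apply: (@cvg_unique _ (@norm_hausdorff _ K) _ _ _ _ (T0P _)).
  have lim2 : a *: T y u + T y v @[y --> 0^'+] --> a *: T0 u + T0 v.
    by apply: cvgD; [apply: cvgZr|]; exact: T0P.
  apply: cvg_trans lim2; apply: near_eq_cvg; exists 1 => //= y _ y0.
  by rewrite (proj1 (Tb y y0)).
have [d d0 dT] := T0c 1 ltr01; pose y := d / 2.
have yd : 0 < y < d by rewrite divr_gt0 // ltr_pdivrMr // ltr_pMr // ltr1n.
have /bounded_opP[Tyl [M M0 bM]] := Tb y (proj1 (andP yd)).
apply/bounded_opP; split=> //; exists (M + 1); first by rewrite addr_ge0.
move=> x; have -> : T0 x = T y x - (T y x - T0 x) by rewrite opprB addrC subrK.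
by rewrite (le_trans (rnormB _ _)) // mulrDl lerD // dT.
Qed.

(** If [T y] solves [T y + S y P T y = S y] and the limit operator
    [1 + S0 P] is bounded below, then [T y] has a norm limit. *)
Lemma perturbed_limit S (S0 P : K -> K) T (c : R) :
  (forall y, 0 < y -> linear (S y)) -> bounded_op S0 -> bounded_op P ->
  norm_cvg 0^'+ S S0 -> (forall y, 0 < y -> bounded_op (T y)) ->
  (forall y, 0 < y -> forall k, T y k + S y (P (T y k)) = S y k) ->
  0 < c -> (forall u, c * rnorm u <= rnorm (u + S0 (P u))) ->
  exists2 T0 : K -> K, bounded_op T0 & norm_cvg 0^'+ T T0.
Proof.
move=> Sl /bounded_opP[S0l [M M0 bM]] /bounded_opP[Pl [N N0 bN]] /norm_cvg_at0P Sc.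
move=> Tb Teq c0 low.
pose C := (M + 1) * 2 / c.
have C0 : 0 < C by rewrite divr_gt0 // mulr_gt0 // ltr_wpDl.
have near_bound : exists2 d : R, 0 < d & forall y, 0 < y < d ->
    forall x, rnorm (T y x) <= C * rnorm x.
  pose e := Num.min 1 (c / 2 / (N + 1)).
  have N1 : 0 < N + 1 by rewrite ltr_wpDl.
  have e0 : 0 < e by rewrite lt_min ltr01 /= !divr_gt0.
  have eN : e * N <= c / 2.
    have : e * (N + 1) <= c / 2 by rewrite -ler_pdivlMr // /e ge_min lexx orbT.
    by apply: le_trans; rewrite ler_wpM2l ?lerDl // ltW.
  have e1 : e <= 1 by rewrite /e ge_min lexx.
  have [d d0 dS] := Sc _ e0; exists d => // y yd x.
  have y0 := proj1 (andP yd).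
  set u := T y x.
  have hu : u + S0 (P u) = S y x - (S y (P u) - S0 (P u)).
    by rewrite -(Teq y y0 x) -/u opprB [RHS]addrA [RHS]addrAC addrK.
  have Syx : rnorm (S y x) <= (M + 1) * rnorm x.
    have -> : S y x = S0 x + (S y x - S0 x) by rewrite addrC subrK.
    rewrite (le_trans (rnormD _ _)) // mulrDl lerD // (le_trans (dS _ yd _)) //.
    by rewrite ler_wpM2r // rnorm_ge0.
  have : c * rnorm u <= (M + 1) * rnorm x + c / 2 * rnorm u.
    rewrite (le_trans (low u)) // hu (le_trans (rnormB _ _)) // lerD //.
    rewrite (le_trans (dS _ yd _)) // (le_trans _ (ler_wpM2r (rnorm_ge0 u) eN)) //.
    by rewrite -mulrA ler_wpM2l // ltW.
  rewrite -lerBlDr -mulrBl (_ : c - c / 2 = c / 2); last by field.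
  rewrite -ler_pdivlMl ?divr_gt0 // => /le_trans; apply.
  by rewrite mulrA ler_wpM2r ?rnorm_ge0 // invf_div mulrC /C mulrA.
have [d1 d10 dT] := near_bound.
apply: op_cauchy_cvg => // e e0.
pose f := e * c / 2 / (N * C + 1).
have NC : 0 < N * C + 1 by rewrite ltr_wpDl // mulr_ge0 // ltW.
have f0 : 0 < f by rewrite !divr_gt0 // mulr_gt0.
have [d2 d20 dS] := Sc _ f0; exists (Num.min d1 d2); first by rewrite lt_min d10.
move=> y y' /andP[y0 yd] /andP[y'0 yd'] x.
move: yd yd'; rewrite !lt_min => /andP[yd1 yd2] /andP[y'd1 y'd2].
have step t : 0 < t -> t < d1 -> t < d2 ->
    rnorm ((T t x + S0 (P (T t x))) - S0 x) <= e * c / 2 * rnorm x.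
  move=> t0 td1 td2.
  have td : 0 < t < d2 by rewrite t0.
  have -> : T t x + S0 (P (T t x)) - S0 x =
      (S t x - S0 x) - (S t (P (T t x)) - S0 (P (T t x))).
    by rewrite -(Teq t t0 x) opprB !addrA [RHS](ACl (1*4*3*2*5))%AC /= addrK.
  rewrite (le_trans (rnormB _ _)) // (le_trans (lerD (dS _ td _) (dS _ td _))) //.
  rewrite -mulrDr (_ : e * c / 2 = f * (N * C + 1)); last first.
    by rewrite /f divfK // gt_eqF.
  rewrite -mulrA ler_wpM2l ?(ltW f0) // mulrDl mul1r addrC lerD2r.
  rewrite (le_trans (bN _)) // -mulrA ler_wpM2l // dT // t0 //.
rewrite -(ler_pM2l c0) (le_trans (low _)) //.
have -> : T y x - T y' x + S0 (P (T y x - T y' x)) =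
    (T y x + S0 (P (T y x)) - S0 x) - (T y' x + S0 (P (T y' x)) - S0 x).
  by rewrite (linB Pl) (linB S0l) opprB [RHS]addrA subrK opprD !addrA; congr (_ - _);
     rewrite addrAC.
rewrite (le_trans (rnormB _ _)) // (le_trans (lerD (step y _ _ _) (step y' _ _ _))) //.
by rewrite -mulrDl [c * (_ * _)]mulrA [c * e]mulrC -splitr.
Qed.

(** The equation solved by [T y] passes to the limit. *)
Lemma perturbed_limit_eq S (S0 P : K -> K) T (T0 : K -> K) :
  bounded_op S0 -> bounded_op P -> bounded_op T0 ->
  norm_cvg 0^'+ S S0 -> norm_cvg 0^'+ T T0 ->
  (forall y, 0 < y -> forall k, T y k + S y (P (T y k)) = S y k) ->
  forall k, T0 k + S0 (P (T0 k)) = S0 k.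
Proof.
move=> /bounded_opP[S0l [M M0 bM]] /bounded_opP[Pl [N N0 bN]].
move=> /bounded_opP[T0l [L L0 bL]] /norm_cvg_at0P Sc /norm_cvg_at0P Tc Teq k.
apply/eqP; rewrite -subr_eq0; apply/eqP/rnorm0_eq0/eqP.
rewrite eq_le rnorm_ge0 andbT; apply/ler_addgt0Pr => e e0; rewrite add0r.
pose n := (2 + M * N + N * (L + 1)) * rnorm k + 1.
have n0 : 0 < n by rewrite ltr_wpDl // mulr_ge0 ?rnorm_ge0 // !addr_ge0 // mulr_ge0 // addr_ge0.
pose f := Num.min 1 (e / n).
have f0 : 0 < f by rewrite lt_min ltr01 divr_gt0.
have f1 : f <= 1 by rewrite /f ge_min lexx.
have [d1 d10 dS] := Sc _ f0; have [d2 d20 dT] := Tc _ f0.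
have md : 0 < Num.min d1 d2 by rewrite lt_min d10.
pose y := Num.min d1 d2 / 2; have y0 : 0 < y by rewrite divr_gt0.
have : y < Num.min d1 d2 by rewrite ltr_pdivrMr // ltr_pMr // ltr1n.
rewrite lt_min => /andP[yd1 yd2].
have Sy := dS y (introT andP (conj y0 yd1)).
have Ty := dT y (introT andP (conj y0 yd2)).
have -> : T0 k + S0 (P (T0 k)) - S0 k =
    (S y k - S0 k) - (T y k - T0 k) - S0 (P (T y k - T0 k))
     - (S y (P (T y k)) - S0 (P (T y k))).
  rewrite (linB Pl) (linB S0l) -(Teq y y0 k).
  move: (T y k) (T0 k) (S0 _) (S0 _) (S0 _) (S y _) => a b c c' c'' s.
  rewrite !opprB !addrA subrK [RHS](ACl (4*6*3*1*5*2*7))%AC /=.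
  by rewrite addrK addrK.
have Tyk : rnorm (T y k) <= (L + 1) * rnorm k.
  have -> : T y k = T0 k + (T y k - T0 k) by rewrite addrC subrK.
  rewrite (le_trans (rnormD _ _)) // mulrDl lerD // (le_trans (Ty _)) //.
  by rewrite ler_wpM2r // rnorm_ge0.
have h : f * n <= e by rewrite -ler_pdivlMr // /f ge_min lexx orbT.
rewrite (le_trans _ h) //.
rewrite (le_trans (rnormB _ _)) //.
rewrite (@le_trans _ _ (f * (2 + M * N) * rnorm k + f * (N * (L + 1)) * rnorm k)) //.
  apply: lerD.
    rewrite (le_trans (rnormB _ _)) // mulrDr mulrDl lerD //.
      rewrite (le_trans (rnormB _ _)) // (le_trans (lerD (Sy _) (Ty _))) //.
      by rewrite -mulrDl -mulr2n mulr_natr.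
    rewrite (le_trans (bM _)) // (le_trans (ler_wpM2l M0 (bN _))) //.
    rewrite [f * _]mulrC -!mulrA; do 2![apply: ler_wpM2l => //].
  rewrite (le_trans (Sy _)) // -!mulrA ler_wpM2l ?(ltW f0) //.
  by rewrite (le_trans (bN _)) // ler_wpM2l.
by rewrite -!mulrDl -mulrDr -mulrA ler_wpM2l ?(ltW f0) // lerDl.
Qed.
End Limits.

(** * Resolvents of bounded symmetric operators *)

Section Resolvent.
Variables (R : realType) (H : hilbertType R).

(** Convergence of the Neumann iteration. *)
Lemma contraction_solve (L : H -> H) (q : R) : linear L -> 0 <= q < 1 ->
  (forall x, rnorm (L x) <= q * rnorm x) -> forall f, exists x, x = L x + f.
Proof.
move=> Ll /andP[q0 q1] bL f.
have q1' : 0 < 1 - q by rewrite subr_gt0.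
pose u n := iter n (fun x => L x + f) 0.
pose C := rnorm f / (1 - q).
have C0 : 0 <= C by rewrite divr_ge0 ?rnorm_ge0 // ltW.
have step n m : rnorm (u (n + m)%N - u n) <= C * q ^+ n.
  elim: n => [|n IH]; last first.
    rewrite addSn /= opprD addrACA subrr addr0 -(linB Ll).
    by rewrite (le_trans (bL _)) // exprS mulrCA ler_wpM2l.
  rewrite add0n subr0 mulr1; elim: m => [|m IH]; first by rewrite rnorm0.
  rewrite /= (le_trans (rnormD _ _)) // (le_trans (lerD (bL _) (lexx _))) //.
  rewrite (le_trans (lerD (ler_wpM2l q0 IH) (lexx _))) //.
  have -> : rnorm f = (1 - q) * C by rewrite /C mulrC divfK // gt_eqF.
  by rewrite -mulrDl addrC subrK mul1r.
have small (e : R) : 0 < e -> exists n, C * q ^+ n < e.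
  move=> e0; have : C * q ^+ n @[n --> \oo] --> C * 0.
    by apply: cvgMr; apply: cvg_expr; rewrite ger0_norm.
  rewrite mulr0 => /cvgrPdist_lt /(_ e e0)[n _ /(_ n (leqnn n))].
  by rewrite /= sub0r normrN => h; exists n; rewrite (le_lt_trans (ler_norm _)).
have [x ux] : exists x : H, u @ \oo --> x.
  suff : cvg (u @ \oo) by move=> ?; exists (lim (u @ \oo)).
  apply: cauchy_cvg; apply/rnorm_cauchyP => e e0.
  have [n ne] := small (e / 2) (divr_gt0 e0 (ltr0n _ 2)).
  exists [set u (n + m)%N | m in setT].
    by exists n => // k /= nk; exists (k - n)%N => //; rewrite subnKC.
  move=> _ _ [k _ <-] [l _ <-].
  have -> : u (n + k)%N - u (n + l)%N = (u (n + k)%N - u n) - (u (n + l)%N - u n).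
    by rewrite opprB addrA subrK.
  rewrite (le_lt_trans (rnormB _ _)) // (le_lt_trans (lerD (step _ _) (step _ _))) //.
  by rewrite [ltRHS]splitr ltrD.
exists x; apply/eqP; rewrite -subr_eq0; apply/eqP/rnorm0_eq0/eqP.
rewrite eq_le rnorm_ge0 andbT; apply/ler_addgt0Pr => e e0; rewrite add0r.
have e2 : 0 < e / 2 by rewrite divr_gt0.
move/rnorm_cvgP : ux => /(_ _ e2)[n _ un].
have -> : x - (L x + f) = (x - u n.+1) - L (x - u n).
  by rewrite (linB Ll) /= !opprD opprK !addrA [RHS](ACl (1*4*3*5*2))%AC /= addrK.
rewrite (le_trans (rnormB _ _)) // [leRHS]splitr lerD //.
  by apply: ltW; apply: un => /=.
rewrite (le_trans (bL _)) // (@le_trans _ _ (rnorm (x - u n))) //.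
  by rewrite ler_piMl ?rnorm_ge0 // ltW.
by apply: ltW; apply: un => /=.
Qed.

Variable g : H -> H.
Hypothesis g_bounded : bounded_op g.
Hypothesis g_sym : forall x z, '[g x, z] = '[x, g z].

Lemma sym_real x : im '[g x, x] = 0.
Proof.
have : '[g x, x] = conjc '[g x, x] by rewrite -innerC g_sym.
by case: '[_, _] => a b [] /eqP; rewrite -subr_eq0 opprK -mulr2n mulrn_eq0 /= => /eqP.
Qed.

Lemma sym_shift_norm (y : R) x :
  rnorm (g x - (0 +i* y) *: x) ^+ 2 = rnorm (g x) ^+ 2 + y ^+ 2 * rnorm x ^+ 2.
Proof.
rewrite rnormD_sqr innerNr innerZr reN reM reJ imJ /= rnormN sym_real mul0r mulr0.
rewrite subr0 oppr0 mulr0 addr0; congr (_ + _).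
have -> : 0 +i* y = 'i * y%:C by simpc.
rewrite -scalerA; apply: complexI; rewrite -inner_rnorm innerZl innerZr mulrA.
rewrite -sqr_normc; have -> : `|'i%C| = 1 :> R[i].
  by rewrite normc_def /= expr0n expr1n add0r sqrtr1.
by rewrite expr1n mul1r inner_rnorm rnormZr exprMn real_normK ?num_real.
Qed.

Lemma sym_shift_ge (y : R) x : 0 < y -> y * rnorm x <= rnorm (g x - (0 +i* y) *: x).
Proof.
move=> y0; rewrite -(ler_pXn2r (n := 2)) ?nnegrE ?rnorm_ge0 //; last first.
  by rewrite mulr_ge0 ?rnorm_ge0 // ltW.
by rewrite exprMn sym_shift_norm lerDr sqr_ge0.
Qed.

(** For [y > 0] the operator [y + i g] is accretive, so that
    [w |-> w - eps (y w + i g w)] is a contraction for small [eps]. *)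
Lemma sym_shift_solve (y : R) : 0 < y -> forall f, exists w, g w - (0 +i* y) *: w = f.
Proof.
move=> y0 f; have /bounded_opP[gl [M M0 bM]] := g_bounded.
(* The bound [(1 - e y)^2 + e^2 M^2] is least at [e = y / n], with value
   [1 - y^2 / n]. *)
pose n := y ^+ 2 + M ^+ 2.
have n0 : 0 < n by rewrite ltr_wpDr ?sqr_ge0 // exprn_gt0.
pose e : R := y / n; have e0 : 0 < e by rewrite divr_gt0.
pose L (w : H) := (1 - e * y)%:C *: w - (0 +i* e) *: g w.
have Ll : linear L.
  move=> a u v; rewrite /L gl !scalerDr !scalerA opprD addrACA.
  by rewrite -![_ * a]mulrC -!scalerA scalerN.
have q2 : 0 <= 1 - y ^+ 2 / n < 1.
  rewrite subr_ge0 ler_pdivrMr // mul1r lerDl sqr_ge0 /=.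
  by rewrite ltrBlDr ltrDl divr_gt0 // exprn_gt0.
pose q := Num.sqrt (1 - y ^+ 2 / n).
have bL w : rnorm (L w) <= q * rnorm w.
  rewrite -(ler_pXn2r (n := 2)) ?nnegrE ?rnorm_ge0 ?mulr_ge0 ?rnorm_ge0 ?sqrtr_ge0 //.
  rewrite exprMn sqr_sqrtr; last by case/andP: q2.
  have -> : rnorm (L w) ^+ 2 = (1 - e * y) ^+ 2 * rnorm w ^+ 2 + e ^+ 2 * rnorm (g w) ^+ 2.
    rewrite /L rnormD_sqr rnormZr exprMn real_normK ?num_real // -addrA; congr (_ + _).
    have -> : 0 +i* e = 'i * e%:C by simpc.
    rewrite rnormN innerNr -scalerA !innerZr innerZl -g_sym; case E: '[_, _] => [a b].
    have := sym_real w; rewrite E /= => ->; simpc => /=.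
    rewrite ?(mulr0, mul0r, oppr0, subr0, addr0, add0r).
    apply: complexI; rewrite -inner_rnorm innerZl innerZr mulrA.
    rewrite -sqr_normc; have -> : `|'i%C| = 1 :> R[i].
      by rewrite normc_def /= expr0n expr1n add0r sqrtr1.
    by rewrite expr1n mul1r inner_rnorm rnormZr exprMn real_normK ?num_real.
  have gw : rnorm (g w) ^+ 2 <= M ^+ 2 * rnorm w ^+ 2.
    by rewrite -exprMn ler_pXn2r ?nnegrE ?rnorm_ge0 ?mulr_ge0 ?rnorm_ge0.
  rewrite (le_trans (lerD (lexx _) (ler_wpM2l (sqr_ge0 e) gw))) // [e ^+ 2 * _]mulrA -mulrDl.
  rewrite ler_wpM2r ?sqr_ge0 // le_eqVlt; apply/orP; left; apply/eqP.
  rewrite /e /n; field.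
  by move: n0; rewrite /n => /lt0r_neq0.
have q1 : 0 <= q < 1.
  by rewrite sqrtr_ge0 /= -[ltRHS]sqrtr1 ltr_sqrt //; case/andP: q2.
have [w hw] := contraction_solve Ll q1 bL ((0 +i* e) *: f).
exists w; move: hw; rewrite /L => /eqP.
have ei : 0 +i* e != 0 :> R[i] by rewrite eq_complex /= eqxx /= gt_eqF.
rewrite -subr_eq0 => /eqP hw.
apply/eqP; rewrite -subr_eq0 -(inj_eq (scalerI ei)) scaler0; apply/eqP.
rewrite -[RHS]hw !scalerBr scalerA.
have -> : (0 +i* e) * (0 +i* y) = - (e * y)%:C by simpc.
rewrite scaleNr opprK rmorphB rmorph1 scalerBl scale1r !opprD !opprK !addrA.
by rewrite subrr add0r; congr (_ - _); rewrite addrC.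
Qed.
End Resolvent.

Section SandwichedResolvent.
Variables (R : realType) (H K : hilbertType R) (F : H -> K) (Fa : K -> H).
Hypotheses (F_bounded : bounded_op F) (Fa_bounded : bounded_op Fa).
Hypothesis F_adj : forall x k, '[F x, k] = '[x, Fa k].

Lemma adj_inner k x : '[Fa k, x] = '[k, F x].
Proof. by rewrite innerC -F_adj -innerC. Qed.

Lemma op_adj_graph : op_adj (graph_of F) = graph_of Fa.
Proof.
apply/seteqP; split=> [[k x] h|[k x] kx u v uv]; last first.
  by rewrite /graph_of /= in kx uv *; rewrite kx uv F_adj.
rewrite /graph_of /=; apply: inner_eq => z.
by rewrite innerC -(h z (F z)) // F_adj -innerC.
Qed.

Variables (G : H -> H) (lam y : R).
Hypotheses (G_bounded : bounded_op G) (y_gt0 : 0 < y).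
Hypothesis G_sym : forall x z, '[G x, z] = '[x, G z].

Let g x := G x - lam%:C *: x.

Let g_bounded : bounded_op g.
Proof.
have /bounded_opP[Gl [M M0 bM]] := G_bounded.
apply/bounded_opP; split.
  move=> a u v; rewrite /g Gl !scalerDr !scalerA opprD addrACA.
  by rewrite -![_ * a]mulrC -!scalerA scalerN.
exists (M + `|lam|); first by rewrite addr_ge0.
by move=> x; rewrite (le_trans (rnormB _ _)) // rnormZr mulrDl lerD.
Qed.

Let g_sym x z : '[g x, z] = '[x, g z].
Proof. by rewrite /g innerBl innerBr G_sym innerZl innerZr conjc_real. Qed.

Let gE w : g w - (0 +i* y) *: w = G w - (lam +i* y) *: w.
Proof.
rewrite /g -addrA -opprD -scalerDl.
by have -> : lam%:C + (0 +i* y) = lam +i* y by simpc.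
Qed.

(** For bounded [F] and symmetric bounded [G] the operator [F (G - z)^-1 F^*]
    is bounded and everywhere defined, so that its graph is already closed. *)
Lemma sandwiched_resolvent_fun : exists2 T : K -> K, bounded_op T &
  graph_of T = sandwiched_resolvent (graph_of F) (graph_of G) (lam +i* y) /\
  forall k, exists2 w, G w - (lam +i* y) *: w = Fa k & T k = F w.
Proof.
have /bounded_opP[Fl [M M0 bM]] := F_bounded.
have /bounded_opP[Fal [N N0 bN]] := Fa_bounded.
have /bounded_opP[gl _] := g_bounded.
have [r rP] := choice (fun k => sym_shift_solve g_bounded g_sym y_gt0 (Fa k)).
have r_uniq k w : g w - (0 +i* y) *: w = Fa k -> w = r k.
  move=> h; apply/eqP; rewrite -subr_eq0; apply/eqP/rnorm0_eq0/eqP.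
  rewrite eq_le rnorm_ge0 andbT -(pmulr_rle0 _ y_gt0).
  rewrite (le_trans (sym_shift_ge g_sym _ y_gt0)) // (linB gl) scalerBr.
  have -> : g w - g (r k) - ((0 +i* y) *: w - (0 +i* y) *: r k) =
      (g w - (0 +i* y) *: w) - (g (r k) - (0 +i* y) *: r k).
    by rewrite !opprB addrACA [in RHS]addrACA [X in _ + X]addrC.
  by rewrite h rP subrr rnorm0.
have rl : linear r.
  move=> a u v; symmetry; apply: r_uniq.
  rewrite Fal -(rP u) -(rP v) gl !scalerDr !scalerN !scalerA opprD addrACA.
  by rewrite [_ * a]mulrC -!scalerA.
have rb k : y * rnorm (r k) <= N * rnorm k.
  by rewrite (le_trans (sym_shift_ge g_sym _ y_gt0)) // rP.
have Tb : bounded_op (F \o r).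
  apply/bounded_opP; split; first by move=> a u v /=; rewrite rl Fl.
  exists (M * (N / y)); first by rewrite !mulr_ge0 // invr_ge0 ltW.
  move=> k /=; rewrite (le_trans (bM _)) // -mulrA ler_wpM2l // mulrAC.
  by rewrite ler_pdivlMr // mulrC.
exists (F \o r) => //; split; last by move=> k; exists (r k) => //; rewrite -gE.
rewrite /sandwiched_resolvent op_adj_graph.
suff -> : (graph_of F \; ((op_shift (graph_of G) (lam +i* y))^-1 \; graph_of Fa))%relation
    = graph_of (F \o r).
  by rewrite -(closure_id _).1 //; exact: closed_graph.
apply/seteqP; split.
  move=> [k u] [w [x kx [v wv h]] hu]; rewrite /graph_of /= in kx wv h hu *.
  by rewrite hu; congr F; apply: r_uniq; rewrite gE -wv -h -kx.
move=> [k u] ku; exists (r k) => //; exists (Fa k) => //.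
by exists (G (r k)) => //=; rewrite -gE.
Qed.
End SandwichedResolvent.

(** * The Hilbert space of square-summable complex sequences *)

Section ComplexSeries.
Variable R : realType.
Implicit Types (a b : nat -> R[i]) (s t : R[i]).

(** [has_csum a s]: the complex series with terms [a n] converges to [s]. *)
Definition has_csum a s :=
  series (fun n => re (a n)) @ \oo --> re s /\ series (fun n => im (a n)) @ \oo --> im s.

Lemma has_csum_unique a s t : has_csum a s -> has_csum a t -> s = t.
Proof.
by move=> [r1 i1] [r2 i2]; apply: complexP; [apply: cvg_unique r1 r2|apply: cvg_unique i1 i2].
Qed.

Lemma has_csumD a b s t : has_csum a s -> has_csum b t -> has_csum (fun n => a n + b n) (s + t).
Proof.
move=> [r1 i1] [r2 i2]; split.
  rewrite reD (_ : series _ = series (fun n => re (a n)) + series (fun n => re (b n))).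
    exact: cvgD.
  by apply/funext => n; rewrite fctE /series /= -big_split /=; under eq_bigr do rewrite reD.
rewrite imD (_ : series _ = series (fun n => im (a n)) + series (fun n => im (b n))).
  exact: cvgD.
by apply/funext => n; rewrite fctE /series /= -big_split /=; under eq_bigr do rewrite imD.
Qed.

Lemma has_csumZ (c : R[i]) a s : has_csum a s -> has_csum (fun n => c * a n) (c * s).
Proof.
move=> [r i]; split.
  rewrite reM (_ : series _ = (fun n => re c * series (fun n => re (a n)) n
      - im c * series (fun n => im (a n)) n)).
    by apply: cvgB; apply: cvgMr.
  apply/funext => n; rewrite /series /= !mulr_sumr -sumrB.
  by apply: eq_bigr => k _; rewrite reM.
rewrite imM (_ : series _ = (fun n => re c * series (fun n => im (a n)) n
    + im c * series (fun n => re (a n)) n)).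
  by apply: cvgD; apply: cvgMr.
apply/funext => n; rewrite /series /= !mulr_sumr -big_split.
by apply: eq_bigr => k _; rewrite imM.
Qed.

Lemma has_csumJ a s : has_csum a s -> has_csum (fun n => conjc (a n)) (conjc s).
Proof.
move=> [r i]; split.
  by rewrite reJ; under eq_fun do rewrite reJ.
rewrite imJ (_ : series _ = - series (fun n => im (a n))); first exact: cvgN.
apply/funext => n; rewrite fctE /series /= -sumrN.
by apply: eq_bigr => k _; rewrite imJ.
Qed.

(** Absolute convergence. *)
Definition abs_summable a := exists M : R, forall N, series (fun n => cmod (a n)) N <= M.

Lemma bounded_series_cvg (u v : nat -> R) (M : R) : (forall n, `|u n| <= v n) ->
  (forall N, series v N <= M) -> cvgn (series u).
Proof.
move=> uv vM; apply: normed_cvg; apply: nondecreasing_is_cvgn.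
  by apply/nondecreasing_seqP => n; rewrite -subr_ge0 seriesSB normr_ge0.
exists M => _ [N _ <-]; rewrite (le_trans _ (vM N)) //.
by apply: ler_sum => k _; exact: uv.
Qed.

Lemma abs_summable_csum a : abs_summable a -> exists s, has_csum a s.
Proof.
move=> [M aM].
have /cvg_ex[x hx] := bounded_series_cvg (fun n => normr_re_le (a n)) aM.
have /cvg_ex[y hy] := bounded_series_cvg (fun n => normr_im_le (a n)) aM.
by exists (x +i* y).
Qed.
End ComplexSeries.

Section Ell2.
Variable R : realType.

Definition square_summable (f : nat -> R[i]) :=
  exists M : R, forall N, series (fun n => cmod (f n) ^+ 2) N <= M.

Definition ell2_pred : {pred nat -> R[i]} := fun f => `[< square_summable f >].

Lemma ell2_submod : submod_closed ell2_pred.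
Proof.
split=> [|c f g].
  apply/asboolP; exists 0 => N; rewrite /series /= big1 // => k _.
  by rewrite /cmod normr0 expr0n.
move=> /asboolP[M fM] /asboolP[N gN]; apply/asboolP.
exists (2 * cmod c ^+ 2 * M + 2 * N) => n.
apply: (@le_trans _ _ (2 * cmod c ^+ 2 * series (fun n => cmod (f n) ^+ 2) n +
  2 * series (fun n => cmod (g n) ^+ 2) n)); last first.
  by rewrite lerD // ler_wpM2l // mulr_ge0 // sqr_ge0.
rewrite /series /= !mulr_sumr -big_split /=; apply: ler_sum => k _.
rewrite -mulrA -exprMn -cmodM.
have := cmodD (c * f k) (g k); move: (cmod_ge0 (c * f k + g k)).
move: (cmod (c * f k)) (cmod (g k)) (cmod_ge0 (c * f k)) (cmod_ge0 (g k)) => x y x0 y0 z0 z1.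
apply: (@le_trans _ _ ((x + y) ^+ 2)); first by rewrite ler_pXn2r // nnegrE addr_ge0.
by rewrite -subr_ge0 (_ : _ - _ = (x - y) ^+ 2) ?sqr_ge0 //; ring.
Qed.

HB.instance Definition _ := GRing.isSubmodClosed.Build R[i] (nat -> R[i]) ell2_pred
  ell2_submod.

(** Square-summable sequences, as a submodule of all sequences. *)
Record ell2 := Ell2 { ell2_val :> nat -> R[i]; _ : ell2_val \in ell2_pred }.

HB.instance Definition _ := [isSub for ell2_val].
HB.instance Definition _ := [Choice of ell2 by <:].
HB.instance Definition _ := [SubChoice_isSubLmodule of ell2 by <:].

Implicit Types f g h : ell2.

Lemma ell2P f g : f =1 g -> f = g.
Proof. by move=> fg; apply: val_inj; apply/funext. Qed.

Lemma ell2_subE f g n : (f - g) n = f n - g n. Proof. by []. Qed.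
Lemma ell2_0E n : (0 : ell2) n = 0. Proof. by []. Qed.

Lemma ell2_summable f : square_summable f.
Proof. by case: f => f /= /asboolP. Qed.

Lemma mk_ell2 (f : nat -> R[i]) : square_summable f -> f \in ell2_pred.
Proof. by move=> h; apply/asboolP. Qed.

Lemma ell2_mul_summable f g : abs_summable (fun n => f n * conjc (g n)).
Proof.
have [M fM] := ell2_summable f; have [N gN] := ell2_summable g.
exists (M + N) => n; rewrite (le_trans _ (lerD (fM n) (gN n))) //.
rewrite /series /= -big_split /=; apply: ler_sum => k _; rewrite cmodM cmodJ.
have := cmod_ge0 (f k); have := cmod_ge0 (g k).
move: (cmod (f k)) (cmod (g k)) => x y y0 x0.
have := sqr_ge0 (x - y); have := mulr_ge0 x0 y0; nra.
Qed.

(* Given by an opaque existence proof, like the operators below, so that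
   unification never unfolds it. *)
Lemma ell2_inner_spec : {i : ell2 -> ell2 -> R[i] |
  forall f g, has_csum (fun n => f n * conjc (g n)) (i f g)}.
Proof.
exists (fun f g => xget 0 (has_csum (fun n => f n * conjc (g n)))) => f g.
by apply: xgetPex; apply: abs_summable_csum; exact: ell2_mul_summable.
Qed.

Definition ell2_inner : ell2 -> ell2 -> R[i] := sval ell2_inner_spec.

Lemma ell2_innerP f g : has_csum (fun n => f n * conjc (g n)) (ell2_inner f g).
Proof. exact: (svalP ell2_inner_spec). Qed.

Lemma ell2_inner_unique f g s : has_csum (fun n => f n * conjc (g n)) s -> ell2_inner f g = s.
Proof. exact: has_csum_unique (ell2_innerP f g). Qed.

Lemma ell2_innerC f g : ell2_inner f g = conjc (ell2_inner g f).
Proof.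
apply: ell2_inner_unique; have := has_csumJ (ell2_innerP g f).
by under eq_fun do rewrite conjcM conjcK mulrC.
Qed.

Lemma ell2_innerPl c f g h : ell2_inner (c *: f + g) h = c * ell2_inner f h + ell2_inner g h.
Proof.
apply: ell2_inner_unique.
have := has_csumD (has_csumZ c (ell2_innerP f h)) (ell2_innerP g h).
by under eq_fun do rewrite mulrA -mulrDl.
Qed.
End Ell2.

Section Ell2Dot.
Variable R : realType.
Implicit Types f g h : ell2 R.

Lemma ell2_inner_cmod2 f : series (fun n => cmod (f n) ^+ 2) @ \oo --> re (ell2_inner f f).
Proof.
have [h _] := ell2_innerP f f; apply: cvg_trans h.
by under [in X in _ --> X]eq_fun do rewrite -sqr_normc normr_cmod -rmorphXn /=.
Qed.

Lemma ell2_inner_im f : im (ell2_inner f f) = 0.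
Proof.
have : ell2_inner f f = conjc (ell2_inner f f) by rewrite -ell2_innerC.
by case: ell2_inner => a b [] /eqP; rewrite -subr_eq0 opprK -mulr2n mulrn_eq0 /= => /eqP.
Qed.

Lemma ell2_partial_le f N : series (fun n => cmod (f n) ^+ 2) N <= re (ell2_inner f f).
Proof.
have h := ell2_inner_cmod2 (f:=f).
rewrite -(cvg_lim _ h) //; apply: nondecreasing_cvgn_le; last by apply/cvg_ex; eexists; exact: h.
by apply/nondecreasing_seqP => n; rewrite -subr_ge0 seriesSB sqr_ge0.
Qed.

Lemma ell2_inner_gt0 f : f != 0 -> 0 < ell2_inner f f.
Proof.
move=> f0; have [n fn] : exists n, f n != 0.
  apply: contrapT => h; move/eqP: f0; apply; apply: ell2P => n.
  by rewrite ell2_0E; apply/eqP; apply: contrapT => /negP fn; apply: h; exists n.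
have {}fn : 0 < cmod (f n).
  by rewrite -ltcR -normr_cmod normr_gt0.
rewrite ltcE /= ell2_inner_im eqxx /=.
apply: lt_le_trans (ell2_partial_le f n.+1).
rewrite seriesSr ltr_wpDl ?exprn_gt0 //.
by apply: sumr_ge0 => k _; exact: sqr_ge0.
Qed.

Lemma ell2_inner_Bl f : zmod_morphism (@ell2_inner R ^~ f).
Proof.
by move=> x y; rewrite addrC -scaleN1r ell2_innerPl mulN1r addrC.
Qed.

Lemma ell2_inner_Zl f : scalable_for *%R (@ell2_inner R ^~ f).
Proof.
have z0 : ell2_inner 0 f = 0 by rewrite -(subrr 0) ell2_inner_Bl subrr.
by move=> c x; rewrite -[c *: x]addr0 ell2_innerPl z0 addr0.
Qed.

Lemma ell2_inner_Br f : zmod_morphism (ell2_inner f).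
Proof.
by move=> x y; rewrite ell2_innerC ell2_inner_Bl rmorphB /= -!ell2_innerC.
Qed.

Lemma ell2_inner_Zr f : scalable_for (@Num.conj R[i] \; *%R) (ell2_inner f).
Proof.
by move=> c x; rewrite ell2_innerC ell2_inner_Zl rmorphM /= -ell2_innerC.
Qed.

HB.instance Definition _ := isBilinear.Build R[i] (ell2 R) (ell2 R) R[i] *%R
  (@Num.conj R[i] \; *%R) (@ell2_inner R)
  ell2_inner_Bl ell2_inner_Br ell2_inner_Zl ell2_inner_Zr.

Lemma ell2_inner_hermitian f g : ell2_inner f g = (-1) ^+ false * Num.conj (ell2_inner g f).
Proof. by rewrite expr0 mul1r [LHS]ell2_innerC. Qed.

HB.instance Definition _ := isHermitianSesquilinear.Build R[i] (ell2 R) false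
  (@Num.conj R[i]) (@ell2_inner R) ell2_inner_hermitian.

HB.instance Definition _ := isDotProduct.Build R[i] (ell2 R) (@ell2_inner R) ell2_inner_gt0.

Definition ell2_dot : {dot (ell2 R) for @Num.conj R[i]} := @ell2_inner R.

Definition ell2_norm f : R[i] := (Num.sqrt (re (ell2_inner f f)))%:C.

Lemma ell2_inner_re_ge0 f : 0 <= re (ell2_inner f f).
Proof. by rewrite (le_trans _ (ell2_partial_le f 0)) // /series /= big_geq. Qed.

Lemma ell2_normD f g : ell2_norm (f + g) <= ell2_norm f + ell2_norm g.
Proof.
rewrite /ell2_norm -rmorphD lecR.
set x := Num.sqrt _; set y := Num.sqrt (re (ell2_inner f f)); set z := Num.sqrt _.
have x0 : 0 <= x by exact: sqrtr_ge0.
have y0 : 0 <= y by exact: sqrtr_ge0.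
have z0 : 0 <= z by exact: sqrtr_ge0.
rewrite -(ler_pXn2r (n := 2)) ?nnegrE ?addr_ge0 // /x sqr_sqrtr ?ell2_inner_re_ge0 //.
rewrite (formD_sqr ell2_dot) /= sqrrD.
have y2 : y ^+ 2 = re (ell2_inner f f) by rewrite sqr_sqrtr ?ell2_inner_re_ge0.
have z2 : z ^+ 2 = re (ell2_inner g g) by rewrite sqr_sqrtr ?ell2_inner_re_ge0.
rewrite y2 z2 lerD2r lerD2l -[leRHS]mulr_natl ler_wpM2l //.
rewrite (le_trans (ler_norm _)) // (le_trans (normr_re_le _)) //.
rewrite -(ler_pXn2r (n := 2)) ?nnegrE ?mulr_ge0 ?cmod_ge0 // exprMn.
by rewrite y2 z2 (form_cauchy_schwarz ell2_dot).
Qed.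

Lemma ell2_normZ (c : R[i]) f : ell2_norm (c *: f) = `|c| * ell2_norm f.
Proof.
rewrite /ell2_norm (formZl ell2_dot) (formZr ell2_dot) mulrA -sqr_normc (form_real ell2_dot).
rewrite normr_cmod -rmorphXn -!rmorphM /= sqrtrM ?sqr_ge0 //.
by rewrite sqrtr_sqr ger0_norm ?cmod_ge0.
Qed.

Lemma ell2_norm0 f : ell2_norm f = 0 -> f = 0.
Proof.
move=> /complexI/eqP; rewrite sqrtr_eq0 => h; apply/eqP; apply: contraLR h => /ell2_inner_gt0.
by rewrite ltcE /= -ltNge => /andP[].
Qed.

HB.instance Definition _ := Lmodule_isNormed.Build R[i] (ell2 R)
  ell2_normD ell2_normZ ell2_norm0.

Lemma ell2_rnormE f : rnorm f ^+ 2 = re (ell2_inner f f).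
Proof. by rewrite /rnorm /= sqr_sqrtr // ell2_inner_re_ge0. Qed.

Lemma ell2_rnorm_cvg f : series (fun n => cmod (f n) ^+ 2) @ \oo --> rnorm f ^+ 2.
Proof. by rewrite ell2_rnormE; exact: ell2_inner_cmod2. Qed.

Lemma ell2_series_le f N : series (fun n => cmod (f n) ^+ 2) N <= rnorm f ^+ 2.
Proof. by rewrite ell2_rnormE; exact: ell2_partial_le. Qed.

Lemma ell2_rnorm_le f (M : R) : 0 <= M ->
  (forall N, series (fun n => cmod (f n) ^+ 2) N <= M ^+ 2) -> rnorm f <= M.
Proof.
move=> M0 h; rewrite -(ler_pXn2r (n := 2)) ?nnegrE ?rnorm_ge0 //.
have c := ell2_rnorm_cvg (f:=f); rewrite -(cvg_lim _ c) //.
by apply: limr_le; [apply/cvg_ex; eexists; exact: c|exact: nearW].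
Qed.

Lemma ell2_coord_le f n : cmod (f n) <= rnorm f.
Proof.
rewrite -(ler_pXn2r (n := 2)) ?nnegrE ?rnorm_ge0 ?cmod_ge0 //.
apply: le_trans (ell2_series_le f n.+1).
by rewrite seriesSr lerDr sumr_ge0 // => k _; exact: sqr_ge0.
Qed.
End Ell2Dot.

Section Ell2Complete.
Variable R : realType.

Lemma ell2_coord_cvg (F : set_system (ell2 R)) n : ProperFilter F -> cauchy F ->
  exists z : R[i], forall e : R, 0 < e -> \forall f \near F, cmod (z - (f : ell2 R) n) < e.
Proof.
move=> FF cF.
have part (p : R[i] -> R) : (forall z w, p (z - w) = p z - p w) ->
    (forall z, `|p z| <= cmod z) -> exists x : R, (fun f : ell2 R => p (f n)) @ F --> x.
  move=> pB pc; apply/cvg_ex; apply: cauchy_cvg; apply: cauchy_exP => e e0.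
  have /rnorm_cauchyP /(_ e e0)[A FA Ae] := cF.
  have [f0 Af0] := filter_ex FA.
  exists (p (f0 n)); suff : F [set f : ell2 R | ball (p (f0 n)) e (p (f n))] by [].
  apply: filterS FA => f Af; rewrite -ball_normE /= -pB.
  by rewrite (le_lt_trans (pc _)) // (le_lt_trans (ell2_coord_le (f0 - f) n)) // Ae.
have [|x hx] := part (@complex.Re _) _ (@normr_re_le R).
  by move=> z w; rewrite reD reN.
have [|y hy] := part (@complex.Im _) _ (@normr_im_le R).
  by move=> z w; rewrite imD imN.
exists (x +i* y) => e e0.
have e2 : 0 < e / 2 by rewrite divr_gt0.
move/cvgrPdist_lt : hx => /(_ _ e2) hx; move/cvgrPdist_lt : hy => /(_ _ e2) hy.
apply: filterS2 hx hy => f; case: (f n) => a b /= hx hy.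
have -> : (x +i* y) - (a +i* b) = (x - a)%:C + 'i * (y - b)%:C by simpc.
rewrite (le_lt_trans (cmodD _ _)) // cmodM !cmodR.
rewrite {1}/cmod normc_def /= expr0n expr1n add0r sqrtr1 mul1r.
by rewrite (splitr e) ltrD.
Qed.

Lemma cmod_series_lim (F : set_system (ell2 R)) (FF : ProperFilter F) (u : nat -> R[i])
    (f : ell2 R) (M : R) N :
  (forall n (e : R), 0 < e -> \forall g \near F, cmod (u n - (g : ell2 R) n) < e) ->
  (\forall g \near F, series (fun n => cmod (f n - (g : ell2 R) n) ^+ 2) N <= M) ->
  series (fun n => cmod (f n - u n) ^+ 2) N <= M.
Proof.
move=> ug gM.
have cv n : (fun g : ell2 R => cmod (f n - g n) ^+ 2) @ F --> cmod (f n - u n) ^+ 2.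
  have c1 : (fun g : ell2 R => cmod (f n - g n)) @ F --> cmod (f n - u n).
    apply/cvgrPdist_lt => e e0; apply: filterS (ug n e e0) => g h.
    rewrite (le_lt_trans (cmod_dist _ _)) // opprB addrC addrA subrK.
    by rewrite -cmodN opprB.
  by rewrite expr2; under eq_fun do rewrite expr2; exact: cvgM.
have cs : (fun g : ell2 R => series (fun n => cmod (f n - g n) ^+ 2) N) @ F
    --> series (fun n => cmod (f n - u n) ^+ 2) N.
  elim: N {gM} => [|N IH].
    by rewrite !/series /= big_geq //; under eq_fun do rewrite big_geq //; exact: cvg_cst.
  by rewrite seriesSr; under eq_fun do rewrite seriesSr; exact: cvgD.
rewrite -(cvg_lim _ cs) //; apply: limr_le => //.
by apply/cvg_ex; eexists; exact: cs.
Qed.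

Lemma ell2_complete (F : set_system (ell2 R)) : ProperFilter F -> cauchy F -> cvg F.
Proof.
move=> FF cF; apply/cvg_ex.
have [u uP] := choice (fun n => ell2_coord_cvg n FF cF).
have key (e : R) (f : ell2 R) : (\forall g \near F, rnorm (f - g) < e) ->
    forall N, series (fun n => cmod (f n - u n) ^+ 2) N <= e ^+ 2.
  move=> fe N; apply: (cmod_series_lim FF uP).
  apply: filterS fe => g ge.
  rewrite (le_trans (ell2_series_le (f - g) N)) // ler_pXn2r ?nnegrE ?rnorm_ge0 // 1?ltW //.
  by rewrite (le_lt_trans (rnorm_ge0 _) ge).
have near_ex (e : R) : 0 < e -> exists f : ell2 R, \forall g \near F, rnorm (f - g) < e.
  move=> e0; have /rnorm_cauchyP /(_ e e0)[A FA Ae] := cF.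
  have [f Af] := filter_ex FA; exists f; apply: filterS FA => g; exact: Ae.
have [f1 f1P] := near_ex 1 ltr01.
have dS : (fun n => f1 n - u n) \in @ell2_pred R.
  by apply/mk_ell2; exists (1 ^+ 2) => N; exact: key.
pose l : ell2 R := f1 - Ell2 dS.
have lE n : l n = u n by rewrite ell2_subE /= opprB addrC subrK.
exists l; apply/(@rnorm_cvgP _ _ _ _ _ id) => e e0.
have [f fP] := near_ex (e / 2) (divr_gt0 e0 (ltr0n _ 2)).
have fl : rnorm (f - l) <= e / 2.
  apply: ell2_rnorm_le => [|N]; first by rewrite divr_ge0 // ltW.
  by have := key _ _ fP N; under eq_fun do rewrite -lE.
apply: filterS fP => g fg.
have -> : l - g = (f - g) - (f - l) by rewrite opprB [RHS]addrC addrA subrK.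
by rewrite (le_lt_trans (rnormB _ _)) // [ltRHS]splitr ltr_leD.
Qed.

HB.instance Definition _ := Uniform_isComplete.Build (ell2 R) ell2_complete.

Lemma ell2_inner_norm (f : ell2 R) : ell2_dot R f f = `|f| ^+ 2.
Proof. by rewrite normr_rnorm -rmorphXn /= ell2_rnormE -(form_real (ell2_dot R)). Qed.

(** The Hilbert space of square-summable sequences indexed by [nat]. *)
Definition l2 : hilbertType R := HilbertType ell2_inner_norm.
End Ell2Complete.
Arguments l2 : simpl never.

Section L2Tools.
Variable R : realType.
Local Notation L2 := (l2 R).
Implicit Types f g : L2.

Lemma l2P f g : f =1 g -> f = g. Proof. exact: ell2P. Qed.
Lemma l2_addE f g n : (f + g) n = f n + g n. Proof. by []. Qed.
Lemma l2_oppE f n : (- f) n = - f n. Proof. by []. Qed.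
Lemma l2_subE f g n : (f - g) n = f n - g n. Proof. by []. Qed.
Lemma l2_scaleE c f n : (c *: f) n = c * f n. Proof. by []. Qed.
Lemma l2_0E n : (0 : L2) n = 0. Proof. by []. Qed.

Lemma mkl2_spec : {m : (nat -> R[i]) -> L2 | forall u, square_summable u -> m u =1 u}.
Proof.
by exists (insubd (0 : ell2 R)) => u h n; rewrite insubdK // mk_ell2.
Qed.

(** The element of [l2] with given coordinates, when these are square-summable. *)
Definition mkl2 : (nat -> R[i]) -> L2 := sval mkl2_spec.

Lemma mkl2E (u : nat -> R[i]) : square_summable u -> mkl2 u =1 u.
Proof. exact: (svalP mkl2_spec). Qed.

Lemma square_summable_le (u : nat -> R[i]) f (M : R) : 0 <= M ->
  (forall n, cmod (u n) <= M * cmod (f n)) -> square_summable u /\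
  forall N, series (fun n => cmod (u n) ^+ 2) N <= (M * rnorm f) ^+ 2.
Proof.
move=> M0 h.
suff : forall N, series (fun n => cmod (u n) ^+ 2) N <= (M * rnorm f) ^+ 2.
  by move=> s; split=> //; exists ((M * rnorm f) ^+ 2).
move=> N; rewrite exprMn.
apply: (@le_trans _ _ (M ^+ 2 * series (fun n => cmod (f n) ^+ 2) N)); last first.
  by rewrite ler_wpM2l ?sqr_ge0 // ell2_series_le.
rewrite /series /= mulr_sumr; apply: ler_sum => k _.
by rewrite -exprMn ler_pXn2r ?nnegrE ?mulr_ge0 ?cmod_ge0.
Qed.

Lemma l2_innerP f g : has_csum (fun n => f n * conjc (g n)) '[f, g].
Proof. exact: ell2_innerP. Qed.

Lemma l2_inner_unique f g s : has_csum (fun n => f n * conjc (g n)) s -> '[f, g] = s.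
Proof. exact: ell2_inner_unique. Qed.

Lemma has_csum_shift (a : nat -> R[i]) s :
  has_csum (fun n => a n.+1) s -> has_csum a (a 0%N + s).
Proof.
move=> [hr hi].
have key (p : R[i] -> R) : series (fun n => p (a n.+1)) @ \oo --> p s ->
    series (fun n => p (a n)) @ \oo --> p (a 0%N) + p s.
  move=> h; rewrite -(cvg_shiftS (series (fun n => p (a n)))).
  rewrite (_ : [sequence _]_n = (fun n => p (a 0%N) + series (fun n => p (a n.+1)) n)).
    by apply: cvgD => //; exact: cvg_cst.
  by apply/funext => n; rewrite /series /= big_nat_recl.
by split; [rewrite reD|rewrite imD]; apply: key.
Qed.

Lemma mulop_spec : {m : (nat -> R[i]) -> L2 -> L2 | forall c (M : R) f,
  (forall n, cmod (c n) <= M) -> forall n, m c f n = c n * f n}.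
Proof.
exists (fun c f => mkl2 (fun n => c n * f n)) => c M f cM n.
have M0 : 0 <= M := le_trans (cmod_ge0 (c 0%N)) (cM 0%N).
rewrite mkl2E //; apply: (proj1 (square_summable_le (f := f) M0 _)) => k.
by rewrite cmodM ler_wpM2r ?cmod_ge0.
Qed.

(** Multiplication by [c], for a bounded sequence [c]; the values for an
    unbounded one are not used. *)
Definition mulop : (nat -> R[i]) -> L2 -> L2 := sval mulop_spec.

Section Mulop.
Variables (c : nat -> R[i]) (M : R).
Hypotheses (cM : forall n, cmod (c n) <= M).

Lemma mulop_bound_ge0 : 0 <= M.
Proof. exact: le_trans (cmod_ge0 (c 0%N)) (cM 0%N). Qed.

Lemma mulopE f n : mulop c f n = c n * f n.
Proof. exact: (svalP mulop_spec _ _ _ cM). Qed.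

Lemma mulop_linear : linear (mulop c).
Proof.
move=> a f g; apply: l2P => n.
by rewrite l2_addE l2_scaleE !mulopE l2_addE l2_scaleE mulrDr mulrCA.
Qed.

Lemma mulop_le f : rnorm (mulop c f) <= M * rnorm f.
Proof.
apply: ell2_rnorm_le => [|N]; first by rewrite mulr_ge0 ?mulop_bound_ge0 ?rnorm_ge0.
apply: (proj2 (square_summable_le (f := f) mulop_bound_ge0 _)) => k.
by rewrite mulopE cmodM ler_wpM2r ?cmod_ge0.
Qed.

Lemma mulop_bounded : bounded_op (mulop c).
Proof.
apply/bounded_opP; split; first exact: mulop_linear.
by exists M; [exact: mulop_bound_ge0|exact: mulop_le].
Qed.
End Mulop.

Lemma mulop_adj (c d : nat -> R[i]) M N f g :
  (forall n, cmod (c n) <= M) -> (forall n, cmod (d n) <= N) ->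
  (forall n, d n = conjc (c n)) -> '[mulop c f, g] = '[f, mulop d g].
Proof.
move=> cM dN dc; apply: l2_inner_unique; have := l2_innerP f (mulop d g).
suff -> : (fun n => f n * conjc (mulop d g n)) = (fun n => mulop c f n * conjc (g n)) by [].
by apply/funext => n; rewrite (mulopE cM) (mulopE dN) dc conjcM conjcK mulrCA mulrA.
Qed.

Lemma mulop_real_adj (c : nat -> R) M f g : (forall n, `|c n| <= M) ->
  '[mulop (fun n => (c n)%:C) f, g] = '[f, mulop (fun n => (c n)%:C) g].
Proof.
have h n : cmod (c n)%:C = `|c n| by exact: cmodR.
by move=> cM; apply: (@mulop_adj _ _ M M) => n; rewrite ?h ?conjc_real.
Qed.

Lemma series_shift (u : nat -> R) N : series u N.+1 = u 0%N + series (fun n => u n.+1) N.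
Proof. by rewrite /series /= big_nat_recl. Qed.

Lemma consl_spec : {m : R[i] -> L2 -> L2 |
  forall a f, m a f =1 (fun n => if n is k.+1 then f k else a)}.
Proof.
exists (fun a f => mkl2 (fun n => if n is k.+1 then f k else a)) => a f; apply: mkl2E.
exists (cmod a ^+ 2 + rnorm f ^+ 2) => -[|N].
  by rewrite /series /= big_geq // addr_ge0 ?sqr_ge0.
by rewrite series_shift /= lerD2l ell2_series_le.
Qed.

(** The sequence [(a, f 0, f 1, ...)]. *)
Definition consl : R[i] -> L2 -> L2 := sval consl_spec.

Lemma consl0 a f : consl a f 0%N = a. Proof. exact: (svalP consl_spec). Qed.
Lemma conslS a f n : consl a f n.+1 = f n. Proof. exact: (svalP consl_spec). Qed.

Lemma taill_series f N : series (fun n => cmod (f n.+1) ^+ 2) N <= rnorm f ^+ 2.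
Proof.
apply: le_trans (ell2_series_le f N.+1); rewrite series_shift lerDr; exact: sqr_ge0.
Qed.

Lemma taill_spec : {m : L2 -> L2 | forall f n, m f n = f n.+1}.
Proof.
exists (fun f => mkl2 (fun n => f n.+1)) => f n; rewrite mkl2E //.
by exists (rnorm f ^+ 2) => N; exact: taill_series.
Qed.

(** The backward shift. *)
Definition taill : L2 -> L2 := sval taill_spec.

Lemma taillE f n : taill f n = f n.+1.
Proof. exact: (svalP taill_spec). Qed.

Lemma taill_le f : rnorm (taill f) <= rnorm f.
Proof.
apply: ell2_rnorm_le => [|N]; first exact: rnorm_ge0.
by under eq_fun do rewrite taillE; exact: taill_series.
Qed.

Lemma consl_taill f : consl (f 0%N) (taill f) = f.
Proof. by apply: l2P => -[|n]; rewrite ?consl0 ?conslS ?taillE. Qed.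

Lemma taill_linear : linear taill.
Proof. by move=> a f g; apply: l2P => n; rewrite l2_addE l2_scaleE !taillE. Qed.

Lemma consl_inner a b f g : '[consl a f, consl b g] = a * conjc b + '[f, g].
Proof.
apply: l2_inner_unique; pose u n := consl a f n * conjc (consl b g n).
have := @has_csum_shift u '[f, g]; rewrite /u !consl0; apply.
by under eq_fun do rewrite !conslS; exact: l2_innerP.
Qed.

Lemma consl_rnorm a f : rnorm (consl a f) <= cmod a + rnorm f.
Proof.
rewrite -(ler_pXn2r (n := 2)) ?nnegrE ?addr_ge0 ?rnorm_ge0 ?cmod_ge0 //.
rewrite -lecR -inner_rnorm consl_inner -sqr_normc normr_cmod inner_rnorm.
rewrite -rmorphXn -rmorphD lecR sqrrD lerD2r lerDl mulrn_wge0 //.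
by rewrite mulr_ge0 ?rnorm_ge0 ?cmod_ge0.
Qed.

(** The standard basis vectors. *)
Fixpoint basis (k : nat) : L2 := if k is j.+1 then consl 0 (basis j) else consl 1 0.

Lemma basisE k n : basis k n = (n == k)%:R.
Proof. by elim: k n => [|k IH] [|n] /=; rewrite ?consl0 ?conslS ?IH. Qed.

Lemma inner_basis f k : '[f, basis k] = f k.
Proof.
elim: k f => [|k IH] f; rewrite -{1}(consl_taill f) /= consl_inner.
  by rewrite inner0r rmorph1 mulr1 addr0.
by rewrite IH rmorph0 mulr0 add0r taillE.
Qed.

Lemma basis_rnorm k : rnorm (basis k) = 1.
Proof.
have : '[basis k, basis k] = 1 by rewrite inner_basis basisE eqxx.
rewrite inner_rnorm => /(@complexI R _ 1) /eqP.
rewrite sqrf_eq1 => /orP[/eqP //|/eqP h].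
by have := rnorm_ge0 (basis k); rewrite h oppr_ge0 ler10.
Qed.

Lemma finsupp_summable (u : nat -> R[i]) N :
  (forall n, (N <= n)%N -> u n = 0) -> square_summable u.
Proof.
move=> u0; exists (\sum_(0 <= n < N) cmod (u n) ^+ 2) => M.
apply: (@le_trans _ _ (\sum_(0 <= n < maxn N M) cmod (u n) ^+ 2)).
  rewrite /series /= [leRHS](big_cat_nat (n := M)) //= ?leq_maxr // lerDl.
  by apply: sumr_ge0 => k _; exact: sqr_ge0.
rewrite (big_cat_nat (n := N)) //= ?leq_maxl // gerDl big_nat big1 // => k /andP[Nk _].
by rewrite u0 // /cmod normr0 expr0n.
Qed.

Lemma l2_tail (u : nat -> R[i]) (e : R) : square_summable u -> 0 < e ->
  exists N, forall M, \sum_(N <= n < M) cmod (u n) ^+ 2 <= e.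
Proof.
move=> us e0; pose f := mkl2 u; have fE := mkl2E us.
have /cvgrPdist_lt /(_ e e0)[N _ NP] := ell2_rnorm_cvg (f := f).
exists N => M; have [MN|NM] := leqP M N; first by rewrite big_geq // ltW.
have := ell2_series_le f M; have := NP N (leqnn N).
rewrite /series /= (big_cat_nat (n := N) (p := M)) //=; last exact: ltnW.
rewrite ltr_norml => /andP[_ h1] h2.
under eq_bigr do rewrite -fE; lra.
Qed.

(** Truncating a vector far away changes it little in norm. *)
Lemma l2_truncate f (e : R) : 0 < e -> exists N, forall g,
  (forall n, (n < N)%N -> g n = f n) -> (forall n, (N <= n)%N -> g n = 0) ->
  rnorm (f - g) <= e.
Proof.
move=> e0; have [N NP] := l2_tail (ell2_summable f) (exprn_gt0 2 e0).
exists N => g gf g0; apply: ell2_rnorm_le => [|M]; first exact: ltW.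
have d k : cmod ((f - g) k) = if (k < N)%N then 0 else cmod (f k).
  rewrite l2_subE; case: ltnP => kN; first by rewrite gf // subrr /cmod normr0.
  by rewrite g0 // subr0.
have -> : (fun n => cmod ((f - g) n) ^+ 2) =
    (fun n => (if (n < N)%N then 0 else cmod (f n)) ^+ 2).
  by apply/funext => n; rewrite d.
apply: le_trans (NP (maxn N M)); rewrite /series /=.
apply: (@le_trans _ _ (\sum_(0 <= n < maxn N M) (if (n < N)%N then 0 else cmod (f n)) ^+ 2)).
  rewrite [leRHS](big_cat_nat (n := M)) //= ?leq_maxr // lerDl.
  by apply: sumr_ge0 => k _; exact: sqr_ge0.
rewrite (big_cat_nat (n := N)) //= ?leq_maxl // big_nat big1 ?add0r; last first.
  by move=> k /andP[_ kN]; rewrite kN expr0n.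
rewrite big_nat [leRHS]big_nat; apply: ler_sum => k /andP[Nk _].
by rewrite ltnNge Nk.
Qed.
End L2Tools.

(** * Diagonal operators: square roots and form sums *)

Section DiagonalOperators.
Variable R : realType.
Local Notation L2 := (l2 R).

(** The operator with real diagonal entries [a n], used for bounded [a]. *)
Definition diag (a : nat -> R) : L2 -> L2 := mulop (fun n => (a n)%:C).

Section Bounded.
Variables (a : nat -> R) (M : R).
Hypothesis aM : forall n, `|a n| <= M.

Let caM n : cmod (a n)%:C <= M. Proof. by rewrite cmodR. Qed.

Lemma diagE f n : diag a f n = (a n)%:C * f n. Proof. exact: (mulopE caM). Qed.
Lemma diag_linear : linear (diag a). Proof. exact: (mulop_linear caM). Qed.
Lemma diag_bounded : bounded_op (diag a). Proof. exact: (mulop_bounded caM). Qed.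
Lemma diag_le f : rnorm (diag a f) <= M * rnorm f. Proof. exact: (mulop_le caM). Qed.
Lemma diag_sym f g : '[diag a f, g] = '[f, diag a g]. Proof. exact: (mulop_real_adj _ _ aM). Qed.

Lemma diag_self_adjoint : self_adjoint (graph_of (diag a)).
Proof.
split; last by apply: op_adj_graph; exact: diag_sym.
- split; first by rewrite /graph_of /= (lin0 diag_linear).
    move=> c p q; rewrite /graph_of /= => -> ->; rewrite diag_linear //.
  by move=> y; rewrite /graph_of /= (lin0 diag_linear).
- rewrite (_ : op_dom _ = setT); first by move=> O [x Ox] _; exists x.
  by apply/seteqP; split=> // x _; exists (diag a x).
Qed.

Lemma diag_basis k : diag a (basis R k) = (a k)%:C *: basis R k.
Proof.
apply: l2P => n; rewrite diagE l2_scaleE basisE.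
by case: eqP => [->|]; rewrite ?mulr0.
Qed.
End Bounded.

Lemma diag_comp (a b : nat -> R) M N f : (forall n, `|a n| <= M) -> (forall n, `|b n| <= N) ->
  diag a (diag b f) = diag (fun n => a n * b n) f.
Proof.
move=> aM bN; have abM n : `|a n * b n| <= M * N by rewrite normrM ler_pM.
by apply: l2P => n; rewrite (diagE aM) (diagE bN) (diagE abM) mulrA rmorphM.
Qed.

Lemma diag_sqrt (a : nat -> R) M : (forall n, 0 <= a n) -> (forall n, a n <= M) ->
  (forall n, `|Num.sqrt (a n)| <= Num.sqrt M) /\
  forall f, diag (fun n => Num.sqrt (a n)) (diag (fun n => Num.sqrt (a n)) f) = diag a f.
Proof.
move=> a0 aM; have sM n : `|Num.sqrt (a n)| <= Num.sqrt M.
  by rewrite ger0_norm ?sqrtr_ge0 // ler_wsqrtr.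
split=> // f; rewrite (diag_comp _ sM sM) /diag; congr mulop; apply/funext => n.
by rewrite -expr2 sqr_sqrtr.
Qed.

Lemma diag_nonneg (a : nat -> R) M : (forall n, 0 <= a n) -> (forall n, a n <= M) ->
  nonneg_op (graph_of (diag a)).
Proof.
move=> a0 aM x y; rewrite /graph_of /= => ->; have [sM <-] := diag_sqrt a0 aM.
by rewrite (diag_sym sM) inner_rnorm ler0c sqr_ge0.
Qed.

Variables (a : nat -> R) (M : R).
Hypotheses (a_ge0 : forall n, 0 <= a n) (a_le : forall n, a n <= M).

Let aM n : `|a n| <= M. Proof. by rewrite ger0_norm. Qed.
Let M0 : 0 <= M. Proof. exact: le_trans (a_ge0 0%N) (a_le 0%N). Qed.
Let s n := Num.sqrt (a n).
Let sM n : `|s n| <= Num.sqrt M.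
Proof. by rewrite ger0_norm ?sqrtr_ge0 // ler_wsqrtr. Qed.

(** A nonnegative self-adjoint [S] with [S S = diag a] satisfies
    [S d = - sqrt (a k) d] for [d = (S - sqrt (a k)) e_k], so that [d = 0]. *)
Lemma sqrt_diag_basis (S : set (L2 * L2)) k : self_adjoint S -> nonneg_op S ->
  (S \; S)%relation = graph_of (diag a) -> S (basis R k, (s k)%:C *: basis R k).
Proof.
move=> [[S00 Sl _] _ Sadj] Snn SS.
have [y /= Sey Syz] : (S \; S)%relation (basis R k, diag a (basis R k)) by rewrite SS.
have sym x u v w : S (x, u) -> S (v, w) -> '[u, v] = '[x, w].
  by move=> xu vw; move: vw; rewrite -{1}Sadj => /(_ x u xu).
pose d := y - (s k)%:C *: basis R k.
suff /eqP : d = 0 by rewrite subr_eq0 => /eqP <-.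
have Sd : S (d, - (s k)%:C *: d).
  have := Sl (- (s k)%:C) _ _ Sey Syz.
  suff -> : - (s k)%:C *: (basis R k, y) + (y, diag a (basis R k)) = (d, - (s k)%:C *: d) by [].
  apply/eqP; rewrite -pair_eqE /pair_eq /= addrC scaleNr eqxx /=; apply/eqP.
  rewrite (diag_basis aM) scalerBr scaleNr scaleNr opprK scalerA -rmorphM /= -expr2.
  by rewrite sqr_sqrtr.
have := Snn _ _ Sd; rewrite innerZl inner_rnorm -rmorphN -rmorphM /= ler0c mulNr oppr_ge0.
move=> h; have [sk|sk] := eqVneq (s k) 0; last first.
  apply: rnorm0_eq0; apply/eqP; rewrite -sqrf_eq0 eq_le sqr_ge0 andbT.
  by rewrite -(pmulr_rle0 _ (x := s k)) // lt_neqAle eq_sym sk sqrtr_ge0.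
have ak : a k = 0.
  by move: sk => /eqP; rewrite sqrtr_eq0 => ak; apply/eqP; rewrite eq_le a_ge0 andbT.
have dy : d = y by rewrite /d sk scale0r subr0.
apply: (@inner_eq0 R (l2 R)).
by rewrite dy (sym _ _ _ _ Sey Syz) (diag_basis aM) ak scale0r inner0r.
Qed.

(** Being self-adjoint, [S] is determined by its values on the basis. *)
Lemma sqrt_diag_unique (S : set (L2 * L2)) : self_adjoint S -> nonneg_op S ->
  (S \; S)%relation = graph_of (diag a) -> S = graph_of (diag s).
Proof.
move=> Ssa Snn SS; have Sb k := sqrt_diag_basis k Ssa Snn SS.
have [[S00 Sl S0] _ Sadj] := Ssa.
have sub x y : S (x, y) -> y = diag s x.
  move=> Sxy; apply: l2P => n; rewrite (diagE sM) -!(inner_basis _ n).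
  have h : '[y, basis R n] = '[x, (s n)%:C *: basis R n].
    by have := Sb n; rewrite -{1}Sadj; apply.
  by rewrite h innerZr conjc_real.
apply/seteqP; split=> [[x y] /sub //|[x y]].
rewrite /graph_of /= => ->.
have [y' Sxy' _] : (S \; S)%relation (x, diag a x) by rewrite SS.
by rewrite -(sub _ _ Sxy').
Qed.

Lemma op_sqrt_diag : op_sqrt (graph_of (diag a)) = graph_of (diag s).
Proof.
rewrite /op_sqrt; set P := [set S | _].
have [] : P (get P).
  apply: getPex; exists (graph_of (diag s)); split.
  - exact: diag_self_adjoint sM.
  - apply: (@diag_nonneg _ (Num.sqrt M)) => n; first exact: sqrtr_ge0.
    by have := sM n; rewrite ger0_norm ?sqrtr_ge0.
  - apply/seteqP; split=> [[x y] [z /= xz zy]|[x y] xy].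
    + by rewrite /graph_of /= in xz zy *; rewrite zy xz /s (diag_sqrt a_ge0 a_le).2.
    + exists (diag s x) => //; rewrite /graph_of /= in xy *.
      by rewrite xy /s (diag_sqrt a_ge0 a_le).2.
exact: sqrt_diag_unique.
Qed.
End DiagonalOperators.

Section PositiveDiagonal.
Variables (R : realType) (a : nat -> R) (c M : R).
Hypotheses (c_gt0 : 0 < c) (ca : forall n, c <= a n) (a_le : forall n, a n <= M).
Local Notation L2 := (l2 R).
Local Notation A := (graph_of (diag a)).

Let a_gt0 n : 0 < a n. Proof. exact: lt_le_trans (ca n). Qed.
Let a_ge0 n : 0 <= a n. Proof. exact: ltW. Qed.
Let aM n : `|a n| <= M. Proof. by rewrite ger0_norm. Qed.
Let iM n : `|(a n)^-1| <= c^-1.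
Proof. by rewrite gtr0_norm ?invr_gt0 // lef_pV2 ?posrE. Qed.

Lemma diag_inv f : diag a (diag (fun n => (a n)^-1) f) = f /\
  diag (fun n => (a n)^-1) (diag a f) = f.
Proof.
split; apply: l2P => n; rewrite (diag_comp _ aM iM, diag_comp _ iM aM).
  rewrite (@diagE _ _ (M * c^-1)) ?divff ?mul1r ?gt_eqF // => k.
  by rewrite normrM ler_pM.
rewrite (@diagE _ _ (c^-1 * M)) ?mulVf ?mul1r ?gt_eqF // => k.
by rewrite normrM ler_pM.
Qed.

Lemma op_abs_diag : op_abs A = A.
Proof.
have [_ _ adjA] := diag_self_adjoint aM; rewrite /op_abs adjA.
have -> : (A \; A)%relation = graph_of (diag (fun n => a n * a n)).
  apply/seteqP; split=> [[x y] [z xz zy]|[x y] xy].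
    by rewrite /graph_of /= in xz zy *; rewrite zy xz (diag_comp _ aM aM).
  by exists (diag a x) => //; rewrite /graph_of /= in xy *; rewrite xy (diag_comp _ aM aM).
rewrite (@op_sqrt_diag _ _ (M * M)) => [|n|n]; first last.
- by rewrite ler_pM.
- by rewrite mulr_ge0.
congr graph_of; congr mulop; apply/funext => n.
by rewrite -expr2 sqrtr_sqr ger0_norm.
Qed.

Lemma op_sgn_diag : op_sgn A = graph_of id.
Proof.
have idb : bounded_op (id : L2 -> L2).
  by apply/bounded_opP; split=> //; exists 1 => // x; rewrite mul1r.
rewrite /op_sgn op_abs_diag [RHS](closure_id _).1; last exact: closed_graph.
congr closure; apply/seteqP; split=> [[u v] [x [u' [k [xu xv ak h]]]]|[u v] uv].
  rewrite /graph_of /op_ker /= in xu xv ak h *.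
  by rewrite xv h xu -(diag_inv k).2 -ak (lin0 (diag_linear iM)) addr0.
rewrite /graph_of /= in uv; exists (diag (fun n => (a n)^-1) u), u, 0.
split; rewrite /graph_of /op_ker /= ?addr0 ?(lin0 (diag_linear aM)) //.
  by rewrite (diag_inv u).1.
by rewrite (diag_inv u).1 uv.
Qed.

Lemma op_sqrt_abs_diag : op_sqrt (op_abs A) = graph_of (diag (fun n => Num.sqrt (a n))).
Proof. by rewrite op_abs_diag (op_sqrt_diag a_ge0 a_le). Qed.

(** For a diagonal operator bounded below by [c > 0] and an everywhere defined
    [F] with adjoint [Fa], the form sum is the operator sum. *)
Lemma form_sum_diag (K : hilbertType R) (F : L2 -> K) (Fa : K -> L2) (J : K -> K) :
  (forall x k, '[F x, k] = '[x, Fa k]) ->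
  form_sum (graph_of F) A J = graph_of (fun x => diag a x + Fa (J (F x))).
Proof.
move=> F_adj; have [sM ss] := diag_sqrt a_ge0 a_le.
rewrite /form_sum op_sqrt_abs_diag op_sgn_diag.
pose S := diag (fun n => Num.sqrt (a n)).
have formE x f : '[diag a x + Fa (J (F x)), f] = '[S x, S f] + '[J (F x), F f].
  by rewrite innerDl -ss (diag_sym sM) (adj_inner F_adj).
apply/seteqP; split=> [[x y] [sg [ug [Fg [h1 h2 h3 h4]]]]|[x y] xy].
  have {}h1 : sg = S x := h1; have {}h2 : ug = sg := h2; have {}h3 : Fg = F x := h3.
  apply: (@inner_eq R (l2 R)) => f.
  by have := h4 f (S f) (F f) erefl erefl; rewrite h2 h1 h3 => <-; rewrite formE.
have {}xy : y = diag a x + Fa (J (F x)) := xy.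
exists (S x), (S x), (F x); split=> // f sf Ff sE FE.
have {}sE : sf = S f := sE; have {}FE : Ff = F f := FE.
by rewrite sE FE -formE -xy.
Qed.
End PositiveDiagonal.

(** * A discrete measure whose Poisson integral converges *)

Section PoissonSum.
Variable R : realType.

Lemma atan_increment (a b : R) : 0 <= a -> a < b ->
  (b - a) / (1 + b ^+ 2) <= atan b - atan a <= (b - a) / (1 + a ^+ 2).
Proof.
move=> a0 ab.
have catan : {within `[a, b], continuous (@atan R)}.
  by apply: continuous_subspaceT => x; exact: continuous_atan.
have [c] := MVT ab (fun x _ => is_derive1_atan x) catan.
rewrite in_itv /= => /andP[ac cb] ->.
have p x : 0 < 1 + x ^+ 2 :> R by rewrite ltr_wpDr ?sqr_ge0.
have ba : 0 <= b - a by lra.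
by apply/andP; split; rewrite [(b - a) / _]mulrC; apply: ler_wpM2r => //;
  rewrite lef_pV2 ?posrE ?p //; rewrite lerD2l; apply: lerXn2r; rewrite ?nnegrE; lra.
Qed.

(** Riemann sums of the Poisson kernel, compared with the arctangent. *)
Lemma poisson_partial (y : R) k : 0 < y ->
  atan (k.+1%:R * y) - atan y <= series (fun j => y / (1 + (j.+1%:R * y) ^+ 2)) k
    <= atan (k%:R * y).
Proof.
move=> y0; elim: k => [|k /andP[IH1 IH2]].
  by rewrite /series /= big_geq // mul1r subrr mul0r atan0 lexx.
have step j : j%:R * y < j.+1%:R * y by rewrite ltr_pM2r // ltr_nat.
have d j : j.+1%:R * y - j%:R * y = y by rewrite -mulrBl -natrB // subSnn mul1r.
have n0 j : 0 <= j%:R * y by rewrite mulr_ge0 // ltW.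
have /andP[_ h1] := atan_increment (n0 k.+1) (step k.+1).
have /andP[h2 _] := atan_increment (n0 k) (step k).
by rewrite !d in h1 h2; rewrite seriesSr; apply/andP; split; lra.
Qed.

Lemma series_pairs (u : nat -> R) k :
  series u k.*2.+1 = u 0%N + series (fun j => u j.*2.+1 + u j.*2.+2) k.
Proof.
elim: k => [|k IH]; first by rewrite /series /= big_nat1 big_geq // addr0.
by rewrite doubleS !(seriesSr _ _.+1) IH seriesSr !addrA.
Qed.

Lemma cvg_pairs (u : nat -> R) (l : R) : series u @ \oo --> l ->
  (fun k => u 0%N + series (fun j => u j.*2.+1 + u j.*2.+2) k) @ \oo --> l.
Proof.
move=> /cvgrPdist_lt h; apply/cvgrPdist_lt => e e0; have [N _ NP] := h e e0.
exists N => //= k Nk; rewrite -series_pairs; apply: NP => /=.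
by rewrite (leq_trans Nk) // -addnn -addnS leq_addr.
Qed.

(** The nonzero points [1, 1, -1, 1/2, -1/2, 1/3, ...], symmetric but for the
    first one. *)
Definition pts (n : nat) : R := if n is m.+1 then (-1) ^+ m / m./2.+1%:R else 1.

Arguments pts : simpl never.

Lemma pts_odd k : pts k.*2.+1 = k.+1%:R^-1.
Proof. by rewrite /pts -signr_odd odd_double expr0 mul1r doubleK. Qed.

Lemma pts_even k : pts k.*2.+2 = - k.+1%:R^-1.
Proof. by rewrite /pts -signr_odd /= odd_double /= expr1 uphalf_double mulN1r. Qed.

Lemma pts_neq0 n : pts n != 0.
Proof.
case: n => [|m]; first exact: oner_neq0.
by rewrite /pts mulf_neq0 ?signr_eq0 // invr_neq0 // pnatr_eq0.
Qed.

Lemma pts_le1 n : `|pts n| <= 1.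
Proof.
case: n => [|m]; first by rewrite /pts normr1.
rewrite /pts normrM normrX normrN1 expr1n mul1r normfV normr_nat.
by rewrite invf_le1 ?ler1n ?ltr0n.
Qed.

Lemma sum_inv_sqr k : series (fun j => j.+1%:R^-1 ^+ 2 : R) k.+1 <= 2 - k.+1%:R^-1.
Proof.
elim: k => [|k IH].
  rewrite /series /= big_nat1 !invr1 expr1n; lra.
rewrite seriesSr.
suff h : (k.+2%:R^-1 ^+ 2 : R) <= k.+1%:R^-1 - k.+2%:R^-1.
  by rewrite (le_trans (lerD IH h)) // addrA subrK.
have p1 : 0 < k.+1%:R :> R by rewrite ltr0n.
have p2 : 0 < k.+2%:R :> R by rewrite ltr0n.
have e : k.+2%:R = k.+1%:R + 1 :> R by rewrite -natr1.
have -> : k.+1%:R^-1 - k.+2%:R^-1 = k.+1%:R^-1 * k.+2%:R^-1 :> R.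
  move: p1 p2; rewrite e; move: (k.+1%:R : R) => p p1 p2; field.
  by rewrite !gt_eqF.
by rewrite expr2 ler_wpM2r ?invr_ge0 ?ler0n // lef_pV2 ?posrE // ler_nat.
Qed.

(** The coordinates [|pts n|] of the vector [phi], except for the first one. *)
Definition phi_seq (n : nat) : R := if n is 0 then 0 else `|pts n|.

Arguments phi_seq : simpl never.

Lemma phi_seq0 : phi_seq 0 = 0. Proof. by []. Qed.
Lemma phi_seqS n : phi_seq n.+1 = `|pts n.+1|. Proof. by []. Qed.

Lemma phi_summable : square_summable (fun n => (phi_seq n)%:C).
Proof.
exists 4 => N.
have mono : nondecreasing_seq (series (fun n => cmod (phi_seq n)%:C ^+ 2)).
  by apply/nondecreasing_seqP => n; rewrite -subr_ge0 seriesSB sqr_ge0.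
apply: le_trans (mono N N.+1.*2.+1 _) _.
  by rewrite (leq_trans (leqnSn N)) // -addnn -addnS leq_addr.
have -> : series (fun n => cmod (phi_seq n)%:C ^+ 2) N.+1.*2.+1 =
    series (fun j => cmod (phi_seq j.*2.+1)%:C ^+ 2 + cmod (phi_seq j.*2.+2)%:C ^+ 2) N.+1.
  by rewrite series_pairs cmodR normr0 expr0n add0r.
apply: (@le_trans _ _ (2 * series (fun j => j.+1%:R^-1 ^+ 2 : R) N.+1)); last first.
  have := sum_inv_sqr N; have : 0 < N.+1%:R^-1 :> R by rewrite invr_gt0 ltr0n.
  by move: (N.+1%:R^-1 : R) (series _ _) => r S; lra.
rewrite /series /= mulr_sumr; apply: ler_sum => j _.
rewrite !cmodR !phi_seqS pts_odd pts_even normrN !normr_id ger0_norm ?invr_ge0 ?ler0n //.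
by rewrite mulr2n mulrDl mul1r.
Qed.

Lemma phi_spec : {p : l2 R | forall n, p n = (phi_seq n)%:C}.
Proof. by exists (mkl2 (fun n => (phi_seq n)%:C)); apply: mkl2E; exact: phi_summable. Qed.

Definition phi : l2 R := sval phi_spec.

Lemma phiE n : phi n = (phi_seq n)%:C.
Proof. exact: (svalP phi_spec). Qed.

(** The resolvent at [iy] of multiplication by [pts]. *)
Definition rpts (y : R) (n : nat) : R[i] := ((pts n)%:C - (0 +i* y))^-1.

Lemma rptsE y n : rpts y n =
  (pts n / (pts n ^+ 2 + y ^+ 2)) +i* (y / (pts n ^+ 2 + y ^+ 2)).
Proof. by rewrite /rpts; simpc; rewrite {1}/GRing.inv /= sqrrN mulNr opprK. Qed.

(** Opposite points cancel in the real part. *)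
Lemma phi_rpts_re y k : re (rpts y k.*2.+1 * phi k.*2.+1 * conjc (phi k.*2.+1))
  + re (rpts y k.*2.+2 * phi k.*2.+2 * conjc (phi k.*2.+2)) = 0.
Proof.
rewrite !phiE !conjc_real !rptsE !phi_seqS !pts_odd !pts_even normrN sqrrN.
by simpc.
Qed.

Lemma phi_rpts_im y k : 0 < y -> im (rpts y k.*2.+1 * phi k.*2.+1 * conjc (phi k.*2.+1))
  + im (rpts y k.*2.+2 * phi k.*2.+2 * conjc (phi k.*2.+2)) =
  2 * (y / (1 + (k.+1%:R * y) ^+ 2)).
Proof.
move=> y0; rewrite !phiE !conjc_real !rptsE !phi_seqS !pts_odd !pts_even normrN sqrrN.
rewrite ger0_norm ?invr_ge0 ?ler0n //=.
have p : 0 < k.+1%:R :> R by rewrite ltr0n.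
move: (k.+1%:R : R) p => a a0.
simpc; have q : 0 < 1 + (a * y) ^+ 2 by rewrite ltr_wpDr ?sqr_ge0.
have -> : a^-1 ^+ 2 + y ^+ 2 = (1 + (a * y) ^+ 2) / a ^+ 2.
  by field; rewrite gt_eqF.
by field; rewrite !gt_eqF.
Qed.

(** The boundary value at 0 of [sum_n (phi n)^2 / (pts n - iy)] is [i pi]. *)
Lemma phi_rpts_limit (y : R) (s : R[i]) : 0 < y ->
  has_csum (fun n => rpts y n * phi n * conjc (phi n)) s ->
  cmod (s - (0 +i* pi)) <= 2 * y.
Proof.
move=> y0 [/cvg_pairs hr /cvg_pairs hi].
have u0 : rpts y 0 * phi 0%N * conjc (phi 0%N) = 0 by rewrite phiE mulr0 mul0r.
have re0 : re s = 0.
  have h : (fun k => re (rpts y 0 * phi 0%N * conjc (phi 0%N)) +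
     series (fun j => re (rpts y j.*2.+1 * phi j.*2.+1 * conjc (phi j.*2.+1)) +
       re (rpts y j.*2.+2 * phi j.*2.+2 * conjc (phi j.*2.+2))) k) = fun=> 0.
    apply/funext => k; rewrite u0 add0r /series /= big1 // => j _; exact: phi_rpts_re.
  by rewrite h in hr; apply: cvg_unique hr (cvg_cst _).
pose P k := series (fun j => y / (1 + (j.+1%:R * y) ^+ 2)) k.
have hP : (fun k => 2 * P k) @ \oo --> im s.
  apply: cvg_trans hi; apply: near_eq_cvg; apply: nearW => k.
  rewrite u0 add0r /P /series /= mulr_sumr; apply: eq_bigr => j _.
  by rewrite phi_rpts_im.
have up : im s <= pi.
  rewrite -(cvg_lim _ hP) //; apply: limr_le; first by apply/cvg_ex; eexists; exact: hP.
  apply: nearW => k; have /andP[_] := poisson_partial k y0; rewrite -/(P k) => h.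
  have := atan_ltpi2 (k%:R * y); lra.
have lo : pi - 2 * y <= im s.
  apply/ler_addgt0Pr => e e0.
  have e4 : 0 < e / 4 by rewrite divr_gt0.
  have /cvgrPdist_lt /(_ _ e4)[X [_ XP]] := @cvgy_atan R.
  move/cvgrPdist_lt : hP => /(_ _ (divr_gt0 e0 (ltr0n _ 2)))[N _ NP].
  pose k := maxn N (Num.truncn (`|X| / y)).+1.
  have Xk : X < k.+1%:R * y.
    rewrite (le_lt_trans (ler_norm _)) // -ltr_pdivrMr //.
    rewrite (lt_le_trans (truncnS_gt _)) // ler_nat (leq_trans (leq_maxr N _)) //.
  have := XP _ Xk; have := NP k (leq_maxl _ _).
  have /andP[+ _] := poisson_partial k y0; rewrite -/(P k) => h1.
  have ay : atan y <= y.
    have /andP[_] := atan_increment (lexx 0) y0.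
    by rewrite atan0 !subr0 expr0n addr0 divr1.
  rewrite !ltr_norml /= => /andP[h2 _] /andP[_ h3].
  lra.
have -> : s - (0 +i* pi) = 'i * (im s - pi)%:C.
  by case: (s) re0 => a b /= ->; simpc.
rewrite cmodM cmodR {1}/cmod normc_def /= expr0n expr1n add0r sqrtr1 mul1r.
rewrite ler_norml; apply/andP; split; lra.
Qed.
End PoissonSum.

Arguments pts : simpl never.
Arguments phi_seq : simpl never.

(** * The rigging *)

Section Model.
Variable R : realType.
Local Notation L2 := (l2 R).
Local Notation pts := (@pts R).

(** The weights of the rigging. *)
Definition pts2 (n : nat) : R := pts n ^+ 2.

Lemma pts2_le1 n : `|pts2 n| <= 1.
Proof. by rewrite /pts2 normrX expr_le1 ?pts_le1. Qed.

Lemma Fop_spec : {F : L2 -> L2 | forall x, F x = consl '[x, phi R] (diag pts2 x)}.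
Proof. by eexists=> x; reflexivity. Qed.

Lemma Fad_spec : {F : L2 -> L2 | forall k, F k = k 0%N *: phi R + diag pts2 (taill k)}.
Proof. by eexists=> x; reflexivity. Qed.

(** The rigging [F x = (<x, phi>, pts 0 ^+ 2 * x 0, pts 1 ^+ 2 * x 1, ...)] and
    its adjoint. *)
Definition Fop : L2 -> L2 := sval Fop_spec.
Definition Fad : L2 -> L2 := sval Fad_spec.

Lemma FopE x : Fop x = consl '[x, phi R] (diag pts2 x).
Proof. exact: (svalP Fop_spec). Qed.
Lemma Fad_def k : Fad k = k 0%N *: phi R + diag pts2 (taill k).
Proof. exact: (svalP Fad_spec). Qed.
Lemma Fop0 x : Fop x 0%N = '[x, phi R]. Proof. by rewrite FopE consl0. Qed.
Lemma FopS x n : Fop x n.+1 = (pts2 n)%:C * x n.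
Proof. by rewrite FopE conslS (diagE pts2_le1). Qed.
Lemma FadE k n : Fad k n = k 0%N * phi R n + (pts2 n)%:C * k n.+1.
Proof. by rewrite Fad_def l2_addE l2_scaleE (diagE pts2_le1) taillE. Qed.

Lemma Fop_adj x k : '[Fop x, k] = '[x, Fad k].
Proof.
rewrite -{1}(consl_taill k) FopE consl_inner Fad_def innerDr innerZr (diag_sym pts2_le1).
by rewrite mulrC.
Qed.

Lemma Fop_linear : linear Fop.
Proof.
move=> a x y; apply: l2P => -[|n]; rewrite l2_addE l2_scaleE.
  by rewrite !Fop0 innerDl innerZl.
by rewrite !FopS l2_addE l2_scaleE mulrDr mulrCA.
Qed.

Lemma Fad_linear : linear Fad.
Proof.
move=> a k l; apply: l2P => n.
rewrite FadE [RHS]l2_addE [in RHS]l2_scaleE !FadE !l2_addE !l2_scaleE.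
by ring.
Qed.

(** A common bound for the norms of [Fop] and [Fad]. *)
Definition Fbound : R := rnorm (phi R) + 1.

Lemma Fbound_ge0 : 0 <= Fbound. Proof. by rewrite addr_ge0 ?rnorm_ge0. Qed.

Lemma Fop_le x : rnorm (Fop x) <= Fbound * rnorm x.
Proof.
rewrite FopE (le_trans (consl_rnorm _ _)) // mulrDl; apply: lerD.
  by rewrite mulrC cauchy_schwarz.
exact: diag_le pts2_le1 x.
Qed.

Lemma Fad_le k : rnorm (Fad k) <= Fbound * rnorm k.
Proof.
rewrite Fad_def (le_trans (rnormD _ _)) // mulrDl; apply: lerD.
  rewrite -lecR rmorphM /= -!normr_rnorm normrZ mulrC ler_wpM2l // normr_cmod normr_rnorm lecR.
  exact: ell2_coord_le.
by rewrite (le_trans (diag_le pts2_le1 _)) // ler_wpM2l // taill_le.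
Qed.

Lemma Fop_bounded : bounded_op Fop.
Proof.
apply/bounded_opP; split; [exact: Fop_linear|exists Fbound; [exact: Fbound_ge0|exact: Fop_le]].
Qed.

Lemma Fad_bounded : bounded_op Fad.
Proof.
apply/bounded_opP; split; [exact: Fad_linear|exists Fbound; [exact: Fbound_ge0|exact: Fad_le]].
Qed.

Lemma Fop_inj x : Fop x = 0 -> x = 0.
Proof.
move=> Fx; apply: l2P => n; have : Fop x n.+1 = 0 by rewrite Fx.
rewrite FopS => /eqP; rewrite mulf_eq0 => /orP[|/eqP->//].
by rewrite (inj_eq (@complexI R) _ 0) /pts2 sqrf_eq0 (negPf (pts_neq0 _ n)).
Qed.

(** A truncation of [taill y] provides all coordinates but the first. The first
    is adjusted by a multiple of a far basis vector, at a small cost in the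
    other ones since [pts2 m / phi m] tends to 0. *)
Lemma Fop_dense : dense (op_ran (graph_of Fop)).
Proof.
move=> O [y Oy] oO.
have /rnorm_nbhsP[e e0 eO] : nbhs y O by exact: open_nbhs_nbhs.
have e4 : 0 < e / 4 by rewrite divr_gt0.
have [N NP] := l2_truncate (taill y) e4.
pose u n : R[i] := if (n < N)%N then y n.+1 / (pts2 n)%:C else 0.
have us : square_summable u.
  by apply: (@finsupp_summable _ _ N) => n Nn; rewrite /u ltnNge Nn.
pose x0 : L2 := mkl2 u; pose c := y 0%N - '[x0, phi R].
pose k := maxn N (Num.truncn (4 * cmod c / e)).
(* A far index with [pts m > 0] and [|c| * pts m <= e / 4]. *)
pose m := k.*2.+1; pose p : R := pts m.
have pE : p = k.+1%:R^-1 by rewrite /p /m pts_odd.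
have p0 : 0 < p by rewrite pE invr_gt0 ltr0n.
have pc : cmod c * p <= e / 4.
  have : 4 * cmod c / e < k.+1%:R.
    by rewrite (lt_le_trans (truncnS_gt _)) // ler_nat ltnS; exact: leq_maxr.
  rewrite ltr_pdivrMr // pE ler_pdivrMr ?ltr0n //.
  by move: (k.+1%:R : R) => t ?; nra.
pose x := x0 + (c / p%:C) *: basis R m.
have phim : phi R m = p%:C by rewrite phiE phi_seqS -/m gtr0_norm.
exists (Fop x); split; last by exists x.
apply: eO.
have -> : y - Fop x = consl 0 (taill y - diag pts2 x0 - (c * p%:C) *: basis R m).
  apply: l2P => -[|n]; rewrite l2_subE.
    rewrite Fop0 consl0 innerDl innerZl (innerC (basis R m)) inner_basis phim conjc_real.
    rewrite divfK; first by rewrite /c addrCA subrr addr0 subrr.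
    by rewrite (inj_eq (@complexI R) _ 0) gt_eqF.
  rewrite FopS conslS !l2_subE taillE (diagE pts2_le1) l2_scaleE /x l2_addE l2_scaleE.
  rewrite mulrDr opprD addrA basisE; congr (_ - _).
  case: eqP => [->|]; rewrite ?mulr0 // !mulr1 /pts2 -/p rmorphXn expr2.
  rewrite mulrCA -mulrA; congr (_ * _).
  by rewrite mulfV ?mulr1 // (inj_eq (@complexI R) _ 0) gt_eqF.
rewrite (le_lt_trans (consl_rnorm _ _)) // /cmod normr0 add0r.
rewrite (le_lt_trans (rnormB _ _)) //.
apply: (@le_lt_trans _ _ (e / 4 + e / 4)); last by lra.
apply: lerD.
  apply: NP => n nN; rewrite (diagE pts2_le1) mkl2E // /u ?nN; last by rewrite ltnNge nN mulr0.
  by rewrite taillE mulrC divfK // (inj_eq (@complexI R) _ 0) /pts2 sqrf_eq0 pts_neq0.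
rewrite -lecR -normr_rnorm normrZ normr_rnorm basis_rnorm mulr1 normr_cmod lecR cmodM cmodR.
by rewrite gtr0_norm.
Qed.
End Model.

(** * The boundary value at the regular operator *)

Section BoundaryValues.
Variable R : realType.
Local Notation L2 := (l2 R).
Local Notation pts := (@pts R).
Local Notation phi := (phi R).

(** Diagonal entries of the resonant operator and of a regular one. *)
Definition res_entries (n : nat) : R := if n is 0 then 2 else 2 + pts n.
Definition reg_entries (n : nat) : R := 2 + pts n.

Lemma reg_entries_bounds n : 1 <= reg_entries n <= 3.
Proof.
by have := pts_le1 R n; rewrite ler_norml /reg_entries => /andP[h1 h2]; apply/andP; split; lra.
Qed.

Lemma res_entries_bounds n : 1 <= res_entries n <= 3.
Proof.
by case: n => [|n]; [apply/andP; split; rewrite /=; lra|exact: reg_entries_bounds].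
Qed.

Lemma res_entries_ge1 n : 1 <= res_entries n. Proof. by have /andP[] := res_entries_bounds n. Qed.
Lemma res_entries_le3 n : res_entries n <= 3. Proof. by have /andP[] := res_entries_bounds n. Qed.
Lemma res_entries_norm n : `|res_entries n| <= 3.
Proof. by rewrite ger0_norm ?res_entries_le3 // (le_trans ler01) // res_entries_ge1. Qed.
Lemma reg_entries_norm n : `|reg_entries n| <= 3.
Proof. by have /andP[h1 h2] := reg_entries_bounds n; rewrite ger0_norm // (le_trans ler01). Qed.

(** The resonant operator and the rigging, as graphs. *)
Definition Hres : set (L2 * L2) := graph_of (diag res_entries).
Definition Frig : set (L2 * L2) := graph_of (@Fop R).

Lemma form_sumE J : form_sum Frig Hres J =
  graph_of (fun x => diag res_entries x + Fad (J (Fop x))).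
Proof. exact: (form_sum_diag ltr01 res_entries_ge1 res_entries_le3 _ (@Fop_adj R)). Qed.

(** The direction leading from [Hres] to the regular operator. *)
Definition Jreg (k : L2) : L2 := k 1%N *: basis R 1.

Lemma Jreg_linear : linear Jreg.
Proof. by move=> a k l; rewrite /Jreg l2_addE l2_scaleE scalerDl scalerA. Qed.

Lemma Jreg_bounded : bounded_op Jreg.
Proof.
apply/bounded_opP; split; first exact: Jreg_linear.
exists 1 => // k; rewrite mul1r /Jreg -lecR -!normr_rnorm normrZ.
rewrite [`|basis R 1|]normr_rnorm basis_rnorm mulr1 normr_cmod normr_rnorm lecR.
exact: ell2_coord_le.
Qed.

Lemma res_reg w : diag reg_entries w = diag res_entries w + Fad (Jreg (Fop w)).
Proof.
apply: l2P => n; rewrite l2_addE (diagE reg_entries_norm) (diagE res_entries_norm).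
rewrite FadE /Jreg FopS !l2_scaleE !basisE mulr0 mul0r add0r.
case: n => [|n]; last by rewrite /= !mulr0 addr0.
have p0 : pts 0 = 1 by []; rewrite /pts2 /reg_entries p0 /= expr1n.
by rewrite rmorphD rmorph1 !mul1r mulr1 mulrDl mul1r.
Qed.

Lemma cmod_pts_sub (y : R) n : 0 < y ->
  [/\ y <= cmod ((pts n)%:C - (0 +i* y)), `|pts n| <= cmod ((pts n)%:C - (0 +i* y)) &
      0 < cmod ((pts n)%:C - (0 +i* y))].
Proof.
move=> y0.
have h1 : y <= cmod ((pts n)%:C - (0 +i* y)).
  by have := normr_im_le ((pts n)%:C - (0 +i* y)); simpc; rewrite /= normrN gtr0_norm.
have h2 := normr_re_le ((pts n)%:C - (0 +i* y)).
split=> //; last exact: lt_le_trans h1.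
by apply: le_trans h2; simpc.
Qed.

Lemma rpts_le (y : R) n : 0 < y -> cmod (rpts y n) <= y^-1.
Proof. by move=> y0; have [h1 h2 h3] := cmod_pts_sub n y0; rewrite cmodV lef_pV2 ?posrE. Qed.

Lemma Tref_spec : {T : R -> L2 -> L2 | forall y k, T y k = Fop (mulop (rpts y) (Fad k))}.
Proof. by eexists=> y k; reflexivity. Qed.

Lemma Tlim_spec : {T : L2 -> L2 | forall k,
  T k = consl ((0 +i* pi) * k 0%N + '[diag pts (taill k), phi]) (diag pts (Fad k))}.
Proof. by eexists=> k; reflexivity. Qed.

(** [T_z] at the regular operator, for [z = 2 + iy], and its boundary value. *)
Definition Tref : R -> L2 -> L2 := sval Tref_spec.
Definition Tlim : L2 -> L2 := sval Tlim_spec.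

Lemma TrefE y k : Tref y k = Fop (mulop (rpts y) (Fad k)).
Proof. exact: (svalP Tref_spec). Qed.
Lemma TlimE k :
  Tlim k = consl ((0 +i* pi) * k 0%N + '[diag pts (taill k), phi]) (diag pts (Fad k)).
Proof. exact: (svalP Tlim_spec). Qed.

Lemma Tlim0 k : Tlim k 0%N = (0 +i* pi) * k 0%N + '[diag pts (taill k), phi].
Proof. by rewrite TlimE consl0. Qed.
Lemma TlimS k n : Tlim k n.+1 = (pts n)%:C * Fad k n.
Proof. by rewrite TlimE conslS (diagE (@pts_le1 R)). Qed.
Lemma TrefS y k n : 0 < y -> Tref y k n.+1 = (pts2 R n)%:C * (rpts y n * Fad k n).
Proof. by move=> y0; rewrite TrefE FopS (mulopE (fun n => rpts_le n y0)). Qed.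
Lemma Tref0 y k : 0 < y -> Tref y k 0%N =
  k 0%N * '[mulop (rpts y) phi, phi] + '[mulop (rpts y) (diag (@pts2 R) (taill k)), phi].
Proof.
move=> y0; have rl := mulop_linear (fun n => rpts_le n y0).
by rewrite TrefE Fop0 Fad_def (linD rl) (linZ rl) innerDl innerZl.
Qed.

Lemma Tref_linear (y : R) : 0 < y -> linear (Tref y).
Proof.
move=> y0 a u v; apply: l2P => -[|n]; rewrite l2_addE l2_scaleE.
  rewrite [LHS]Tref0 // l2_addE l2_scaleE taill_linear (diag_linear (@pts2_le1 R)).
  by rewrite (mulop_linear (fun n => rpts_le n y0)) innerDl innerZl !Tref0 //; ring.
by rewrite !TrefS // Fad_linear l2_addE l2_scaleE; ring.
Qed.

(** The error made in replacing [pts2 n / (pts n - iy)] by [pts n]. *)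
Definition rerr (y : R) (n : nat) : R[i] := (pts2 R n)%:C * rpts y n - (pts n)%:C.

Lemma rerr_le (y : R) n : 0 < y -> cmod (rerr y n) <= y.
Proof.
move=> y0; have [h1 h2 h3] := cmod_pts_sub n y0.
have z0 : (pts n)%:C - (0 +i* y) != 0.
  by apply: contraTneq h3 => ->; rewrite /cmod normr0 ltxx.
have -> : rerr y n = (pts n)%:C * (0 +i* y) / ((pts n)%:C - (0 +i* y)).
  rewrite /rerr /rpts /pts2 rmorphXn /=; move: ((pts n)%:C) (0 +i* y) z0 => p z z0.
  by field.
rewrite !cmodM cmodV cmodR -mulrA mulrCA.
have -> : cmod (0 +i* y) = y.
  by rewrite /cmod normc_def /= expr0n add0r sqrtr_sqr gtr0_norm.
by rewrite -[leRHS]mulr1 ler_wpM2l ?(ltW y0) // ler_pdivrMr // mul1r.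
Qed.

Lemma Tref_sub (y : R) k : 0 < y -> Tref y k - Tlim k =
  consl (('[mulop (rpts y) phi, phi] - (0 +i* pi)) * k 0%N
         + '[mulop (rerr y) (taill k), phi]) (mulop (rerr y) (Fad k)).
Proof.
move=> y0; have rb n := rpts_le n y0; have eb n := rerr_le n y0.
apply: l2P => -[|n]; rewrite l2_subE.
  rewrite Tref0 // Tlim0 consl0.
  have -> : '[mulop (rerr y) (taill k), phi] =
      '[mulop (rpts y) (diag (@pts2 R) (taill k)), phi] - '[diag pts (taill k), phi].
    rewrite -innerBl; congr (inner _ _ _); apply: l2P => n.
    rewrite l2_subE !(mulopE rb) (mulopE eb) (diagE (@pts2_le1 R)) (diagE (@pts_le1 R)).
    by rewrite /rerr; ring.
  ring.
rewrite TrefS // TlimS conslS (mulopE eb) /rerr; ring.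
Qed.

Lemma Tref_dist (y : R) k : 0 < y ->
  rnorm (Tref y k - Tlim k) <= y * (2 + rnorm phi + Fbound R) * rnorm k.
Proof.
move=> y0; have rb n := rpts_le n y0; have eb n := rerr_le n y0.
rewrite Tref_sub // (le_trans (consl_rnorm _ _)) // mulrDr mulrDl; apply: lerD.
  rewrite (le_trans (cmodD _ _)) // mulrDr mulrDl; apply: lerD.
    rewrite cmodM; apply: ler_pM; rewrite ?cmod_ge0 //; last exact: ell2_coord_le.
    rewrite mulrC; apply: phi_rpts_limit => //; have := l2_innerP (mulop (rpts y) phi) phi.
    by under eq_fun do rewrite (mulopE rb).
  rewrite (le_trans (cauchy_schwarz _ _)) // mulrAC ler_wpM2r ?rnorm_ge0 //.
  by rewrite (le_trans (mulop_le eb _)) // ler_wpM2l ?taill_le // ltW.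
by rewrite (le_trans (mulop_le eb _)) // -mulrA ler_wpM2l ?Fad_le // ltW.
Qed.

Lemma Tref_cvg : norm_cvg 0^'+ Tref Tlim.
Proof.
pose C : R := 2 + rnorm phi + Fbound R.
have C0 : 0 < C by rewrite ltr_wpDr ?Fbound_ge0 // ltr_wpDr ?rnorm_ge0.
apply/norm_cvg_at0P => e e0; exists (e / C); first by rewrite divr_gt0.
move=> y /andP[y0 yC] k; rewrite (le_trans (Tref_dist k y0)) // ler_wpM2r ?rnorm_ge0 //.
by rewrite -ler_pdivlMr // ltW.
Qed.

Lemma Tlim_bounded : bounded_op Tlim.
Proof.
apply/bounded_opP; split.
  move=> a k l; apply: l2P => -[|n]; rewrite l2_addE l2_scaleE.
    rewrite !Tlim0 taill_linear (diag_linear (@pts_le1 R)) innerDl innerZl l2_addE l2_scaleE.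
    by ring.
  by rewrite !TlimS Fad_linear l2_addE l2_scaleE mulrDr mulrCA.
exists (pi + rnorm phi + Fbound R).
  by rewrite addr_ge0 ?Fbound_ge0 // addr_ge0 ?rnorm_ge0 ?pi_ge0.
move=> k; rewrite TlimE (le_trans (consl_rnorm _ _)) // mulrDl; apply: lerD.
  rewrite (le_trans (cmodD _ _)) // mulrDl; apply: lerD.
    rewrite cmodM {1}/cmod normc_def /= expr0n add0r sqrtr_sqr ger0_norm ?pi_ge0 //.
    by rewrite ler_wpM2l ?pi_ge0 // ell2_coord_le.
  rewrite (le_trans (cauchy_schwarz _ _)) // mulrC ler_wpM2l ?rnorm_ge0 //.
  by rewrite (le_trans (diag_le (@pts_le1 R) _)) // mul1r taill_le.
by rewrite (le_trans (diag_le (@pts_le1 R) _)) // mul1r Fad_le.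
Qed.
End BoundaryValues.

Arguments Hres R : clear implicits.
Arguments Frig R : clear implicits.

(** * Compactness of the rigging and spectrum of the operator *)

Section HilbertCube.
Variable R : realType.
Local Notation L2 := (l2 R).

(** The sequences bounded termwise by [c]. *)
Definition hilbert_cube (c : L2) : set L2 := [set f | forall n, cmod (f n) <= cmod (c n)].

Lemma ultra_coord_cvg (F : set_system L2) (c : L2) n : UltraFilter F -> F (hilbert_cube c) ->
  exists z : R[i], forall e : R, 0 < e -> \forall f \near F, cmod (z - (f : L2) n) < e.
Proof.
move=> UF Fc.
have part (p : R[i] -> R) : (forall z, `|p z| <= cmod z) ->
    exists x : R, forall e : R, 0 < e -> \forall f \near F, `|x - p ((f : L2) n)| < e.
  move=> pc; pose im_p (f : L2) := p (f n).
  have Fs : (im_p @ F) `[- cmod (c n), cmod (c n)]%classic.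
    suff : F [set f | im_p f \in `[- cmod (c n), cmod (c n)]] by [].
    apply: filterS Fc => f /(_ n) fc /=; rewrite in_itv /= -ler_norml.
    exact: le_trans (pc _) fc.
  have [x [_ xF]] := segment_compact _ Fs; exists x => e e0.
  have [//|nA] := in_ultra_setVsetC [set f : L2 | `|x - p (f n)| < e] UF.
  have [] := xF (~` ball x e) (ball x e) _ (nbhsx_ballx x e e0).
    suff : F [set f | ~ ball x e (im_p f)] by [].
    by apply: filterS nA => f; rewrite /= -ball_normE.
  by move=> t [].
have [x hx] := part _ (@normr_re_le R); have [y hy] := part _ (@normr_im_le R).
exists (x +i* y) => e e0; have e2 : 0 < e / 2 by rewrite divr_gt0.
apply: filterS2 (hx _ e2) (hy _ e2) => f; case: (f n) => a b /= xa yb.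
have -> : (x +i* y) - (a +i* b) = (x - a)%:C + 'i * (y - b)%:C by simpc.
rewrite (le_lt_trans (cmodD _ _)) // cmodM !cmodR.
rewrite {1}/cmod normc_def /= expr0n expr1n add0r sqrtr1 mul1r.
by rewrite (splitr e) ltrD.
Qed.

Lemma near_series (F : set_system L2) (z : nat -> R[i]) : Filter F ->
  (forall n (e : R), 0 < e -> \forall f \near F, cmod (z n - (f : L2) n) < e) ->
  forall N (e : R), 0 < e ->
    \forall f \near F, series (fun n => cmod (z n - (f : L2) n) ^+ 2) N < e.
Proof.
move=> FF h; elim=> [|N IH] e e0.
  by apply: nearW => f; rewrite /series /= big_geq.
have e2 : 0 < e / 2 by rewrite divr_gt0.
have m0 : 0 < Num.min 1 (e / 2) by rewrite lt_min ltr01.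
apply: filterS2 (h N _ m0) (IH _ e2) => f fN fs.
rewrite seriesSr addrC [ltRHS]splitr ltrD //.
move: fN; rewrite lt_min => /andP[f1 f2]; apply: le_lt_trans f2.
by rewrite expr2 ler_piMr ?cmod_ge0 // ltW.
Qed.

(** An ultrafilter on the cube converges coordinatewise, hence in norm since
    the tails are uniformly small. *)
Lemma hilbert_cube_compact (c : L2) : compact (hilbert_cube c).
Proof.
rewrite compact_ultra => F UF Fc.
have [z zP] := choice (fun n => ultra_coord_cvg n UF Fc).
have zc n : cmod (z n) <= cmod (c n).
  apply/ler_addgt0Pr => e e0; have [f [fc fz]] := filter_ex (filterI Fc (zP n e e0)).
  have -> : z n = (z n - f n) + f n by rewrite subrK.
  by rewrite (le_trans (cmodD _ _)) // addrC lerD // ltW.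
have [zs _] := @square_summable_le _ z c 1 ler01 (fun n => etrans (f_equal _ (mul1r _)) (zc n)).
pose l : L2 := mkl2 z; have lE n : l n = z n by exact: mkl2E.
exists l; split; first by move=> n; rewrite lE.
apply/(@rnorm_cvgP _ _ _ _ _ id) => e e0.
have t0 : 0 < e ^+ 2 / 32 by rewrite divr_gt0 // exprn_gt0.
have [N NP] := l2_tail (ell2_summable c) t0.
have h0 : 0 < e ^+ 2 / 8 by rewrite divr_gt0 // exprn_gt0.
apply: filterS2 Fc (near_series _ zP N h0) => f fc fs.
apply: (@le_lt_trans _ _ (e / 2)); last by rewrite ltr_pdivrMr // ltr_pMr // ltr1n.
apply: ell2_rnorm_le => [|M]; first by rewrite divr_ge0 // ltW.
have -> : (fun n => cmod ((l - f) n) ^+ 2) = (fun n => cmod (z n - f n) ^+ 2).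
  by apply/funext => n; rewrite l2_subE lE.
apply: (@le_trans _ _ (\sum_(0 <= n < maxn N M) cmod (z n - f n) ^+ 2)).
  rewrite /series /= [leRHS](big_cat_nat (n := M)) //= ?leq_maxr // lerDl.
  by apply: sumr_ge0 => k _; exact: sqr_ge0.
rewrite (big_cat_nat (n := N)) //= ?leq_maxl //.
have -> : (e / 2) ^+ 2 = e ^+ 2 / 8 + 4 * (e ^+ 2 / 32) by field.
apply: lerD; first exact: ltW.
apply: (@le_trans _ _ (4 * \sum_(N <= n < maxn N M) cmod (c n) ^+ 2)); last by rewrite ler_wpM2l.
rewrite mulr_sumr; apply: ler_sum => n _.
have -> : 4 * cmod (c n) ^+ 2 = (cmod (c n) + cmod (c n)) ^+ 2 by ring.
rewrite ler_pXn2r ?nnegrE ?addr_ge0 ?cmod_ge0 // (le_trans (cmodD _ _)) // cmodN.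
exact: lerD.
Qed.
End HilbertCube.

Section SpectralFacts.
Variable R : realType.
Local Notation L2 := (l2 R).

Lemma Hres_self_adjoint : self_adjoint (Hres R).
Proof. exact: diag_self_adjoint (@res_entries_norm R). Qed.

Lemma Frig_rigging : rigging (Frig R).
Proof.
have Fl := @Fop_linear R.
split; last exact: Fop_dense.
- split; first by rewrite /Frig /graph_of /= (lin0 Fl).
    by move=> a p q; rewrite /Frig /graph_of /= => -> ->; rewrite Fl.
  by move=> y; rewrite /Frig /graph_of /= (lin0 Fl).
- exact: closed_graph (@Fop_bounded R).
- rewrite (_ : op_dom _ = setT); first by move=> O [x Ox] _; exists x.
  by apply/seteqP; split=> // x _; exists (Fop x).
- apply/seteqP; split=> x; first by move=> h; exact: Fop_inj (esym h).
  by move=> ->; rewrite /op_ker /Frig /graph_of /= (lin0 Fl).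
Qed.

Lemma Frig_compact : rel_compact (op_sqrt (op_abs (Hres R))) (Frig R).
Proof.
split; first by move=> x _; exists (Fop x).
pose c : L2 := consl (rnorm (phi R))%:C (basis R 0 + phi R).
rewrite -precompactE.
apply: (@precompact_subset _ _ (hilbert_cube c)); last first.
  apply: compact_precompact; [exact: norm_hausdorff|exact: hilbert_cube_compact].
move=> y [x [w [_ x1 _ xy]]]; have {}xy : y = Fop x := xy.
have {}x1 : rnorm x <= 1 by rewrite -(rnorm_le x 1).
move=> n; rewrite xy; case: n => [|n].
  rewrite Fop0 consl0 cmodR ger0_norm ?rnorm_ge0 //.
  by rewrite (le_trans (cauchy_schwarz _ _)) // ler_piMl // rnorm_ge0.
rewrite FopS conslS l2_addE basisE phiE cmodM.
apply: (@le_trans _ _ (cmod (pts2 R n)%:C)).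
  by rewrite ler_piMr ?cmod_ge0 // (le_trans (ell2_coord_le x n)).
rewrite cmodR; case: n => [|n] /=.
  by rewrite phi_seq0 addr0 /cmod normr1 pts2_le1.
rewrite add0r phi_seqS cmodR normr_id /pts2 expr2 normrM ler_piMr //.
exact: pts_le1.
Qed.

Lemma Hres_eigenvalue n : spectrum (Hres R) (res_entries R n)%:C.
Proof.
move=> [T [_ TE]].
have Sp x : diag (res_entries R) x = (res_entries R n)%:C *: x -> T 0 = x.
  move=> h; suff : graph_of T (0, x) by move=> /esym.
  by rewrite TE; exists (diag (res_entries R) x) => //=; rewrite h subrr.
have h0 : T 0 = 0.
  by apply: Sp; rewrite scaler0 (lin0 (diag_linear (@res_entries_norm R))).
have := Sp (basis R n) (diag_basis (@res_entries_norm R) n); rewrite h0 => h.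
by have := rnorm0 L2; rewrite h basis_rnorm => /eqP; rewrite oner_eq0.
Qed.

(** 2 is the limit of the eigenvalues [2 + 1/(k+1)], hence not isolated. *)
Lemma Hres_essential : essential_spectrum (Hres R) (2 : R)%:C.
Proof.
split; first exact: (@Hres_eigenvalue 0%N).
move=> [[_ [V V2 VS]] _ _].
have /(@rnorm_nbhsP R (R[i]^o))[e e0 eV] := V2.
pose k := Num.truncn e^-1.
have ke : k.+1%:R^-1 < e :> R.
  rewrite -[ltRHS]invrK ltf_pV2 ?posrE ?ltr0n ?invr_gt0 //.
  exact: truncnS_gt.
pose z : R[i] := (res_entries R k.*2.+1)%:C.
have zV : V z.
  apply: eV; rewrite /z /res_entries pts_odd.
  have -> : (2 : R)%:C - (2 + k.+1%:R^-1)%:C = (- k.+1%:R^-1 : R)%:C.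
    by rewrite -rmorphB; congr (_ %:C); ring.
  have -> : rnorm ((- k.+1%:R^-1 : R)%:C : R[i]^o) = cmod (- k.+1%:R^-1 : R)%:C by [].
  by rewrite cmodR normrN ger0_norm // invr_ge0 ler0n.
have : (V `&` (spectrum (Hres R) : set R[i]^o)) z by split => //; exact: Hres_eigenvalue.
rewrite VS => /complexI /eqP; rewrite /res_entries pts_odd -subr_eq0 addrAC subrr add0r.
by rewrite invr_eq0 pnatr_eq0.
Qed.
End SpectralFacts.

(** * Boundary values along an arbitrary direction *)

Section Perturbation.
Variable R : realType.
Local Notation L2 := (l2 R).
Local Notation pts := (@pts R).
Local Notation phi := (phi R).
Local Notation e0 := (basis R 0).
Local Notation e1 := (basis R 1).

Lemma Jreg_sym (x y : L2) : '[Jreg x, y] = '[x, Jreg y].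
Proof.
by rewrite /Jreg innerZl innerZr inner_basis (innerC e1) inner_basis mulrC.
Qed.

Lemma bounded_opD (H K : hilbertType R) (S T : H -> K) :
  bounded_op S -> bounded_op T -> bounded_op (fun x => S x + T x).
Proof.
move=> /bounded_opP[Sl [M M0 bM]] /bounded_opP[Tl [N N0 bN]]; apply/bounded_opP; split.
  by move=> a x y; rewrite Sl Tl scalerDr addrACA.
exists (M + N); first exact: addr_ge0.
by move=> x; rewrite (le_trans (rnormD _ _)) // mulrDl lerD.
Qed.

Lemma bounded_opN (H K : hilbertType R) (S : H -> K) :
  bounded_op S -> bounded_op (fun x => - S x).
Proof.
move=> /bounded_opP[Sl [M M0 bM]]; apply/bounded_opP; split.
  by move=> a x y; rewrite Sl opprD scalerN.
by exists M => // x; rewrite rnormN.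
Qed.

Lemma bounded_op_comp (H K L : hilbertType R) (S : K -> L) (T : H -> K) :
  bounded_op S -> bounded_op T -> bounded_op (fun x => S (T x)).
Proof.
move=> /bounded_opP[Sl [M M0 bM]] /bounded_opP[Tl [N N0 bN]]; apply/bounded_opP; split.
  by move=> a x y; rewrite Tl Sl.
exists (M * N); first exact: mulr_ge0.
by move=> x; rewrite (le_trans (bM _)) // -mulrA ler_wpM2l.
Qed.

Section OneDirection.
Variable J : L2 -> L2.
Hypothesis J_sa : bounded_sa J.

Let G (x : L2) : L2 := diag (@res_entries R) x + Fad (J (Fop x)).

Let G_bounded : bounded_op G.
Proof.
apply: bounded_opD; first exact: (diag_bounded (@res_entries_norm R)).
apply: bounded_op_comp; first exact: Fad_bounded.
by apply: bounded_op_comp; [case: J_sa|exact: Fop_bounded].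
Qed.

Let G_sym (x z : L2) : '[G x, z] = '[x, G z].
Proof.
rewrite /G innerDl innerDr (diag_sym (@res_entries_norm R)).
by rewrite (adj_inner (@Fop_adj R)) (J_sa).2 Fop_adj.
Qed.

(** The direction of the form sum relative to the regular operator. *)
Definition shifted (u : L2) : L2 := J u - Jreg u.

Lemma shifted_bounded : bounded_op shifted.
Proof.
apply: bounded_opD; first by case: J_sa.
by apply: bounded_opN; exact: Jreg_bounded.
Qed.

(** Second resolvent identity, relative to the regular operator. *)
Lemma resolvent_identity (y : R) w k : 0 < y -> G w - (2 +i* y) *: w = Fad k ->
  Fop w + Tref y (shifted (Fop w)) = Tref y k.
Proof.
move=> y0 h; have Tl := Tref_linear y0.
suff E : Fop w = Tref y (k - shifted (Fop w)) by rewrite {1}E (linB Tl) subrK.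
rewrite TrefE; congr Fop.
have h2 : diag (@reg_entries R) w - (2 +i* y) *: w = Fad (k - shifted (Fop w)).
  rewrite (linB (@Fad_linear R)) /shifted (linB (@Fad_linear R)) -h res_reg /G.
  move: (diag _ w) (Fad (J _)) (Fad (Jreg _)) (_ *: w) => a b c d.
  by rewrite opprB !addrA [RHS](ACl (1*4*3*(2*5)))%AC /= subrr addr0.
rewrite -h2; apply: l2P => n; rewrite (mulopE (fun n => rpts_le n y0)).
rewrite l2_subE l2_scaleE (diagE (@reg_entries_norm R)) -mulrBl mulrA.
have [_ _ h3] := cmod_pts_sub n y0.
have z0 : (pts n)%:C - (0 +i* y) != 0.
  by apply: contraTneq h3 => ->; rewrite /cmod normr0 ltxx.
have -> : (reg_entries R n)%:C - (2 +i* y) = (pts n)%:C - (0 +i* y).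
  by apply: complexP; rewrite !(reD, imD) /reg_entries /=; ring.
by rewrite /rpts mulVf // mul1r.
Qed.

Lemma sandwiched_exists (y : R) : 0 < y -> exists2 T : L2 -> L2, bounded_op T &
  graph_of T = sandwiched_resolvent (Frig R) (form_sum (Frig R) (Hres R) J) (2 +i* y) /\
  forall k, T k + Tref y (shifted (T k)) = Tref y k.
Proof.
move=> y0; have [T Tb [TE Tw]] := sandwiched_resolvent_fun (@Fop_bounded R) (@Fad_bounded R)
  (@Fop_adj R) 2 G_bounded y0 G_sym.
exists T => //; split; first by rewrite form_sumE.
by move=> k; have [w wk ->] := Tw k; exact: resolvent_identity.
Qed.

Lemma sandwiched_identity (y : R) (T : L2 -> L2) k : 0 < y ->
  graph_of T = sandwiched_resolvent (Frig R) (form_sum (Frig R) (Hres R) J) (2 +i* y) ->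
  T k + Tref y (shifted (T k)) = Tref y k.
Proof.
move=> y0 TE; have [T' _ [T'E T'k]] := sandwiched_exists y0.
suff -> : T k = T' k by exact: T'k.
have : graph_of T' (k, T k) by rewrite T'E -TE.
by [].
Qed.

Lemma boundary_identity (T : L2 -> L2) :
  is_boundary_value (Frig R) (form_sum (Frig R) (Hres R) J) 2 T ->
  forall k, T k + Tlim (shifted (T k)) = Tlim k.
Proof.
move=> [Tb [Ty [Typ Tc]]].
apply: (perturbed_limit_eq (@Tlim_bounded R) shifted_bounded Tb (@Tref_cvg R) Tc) => y y0 k.
by have [_ TyE] := Typ y y0; exact: sandwiched_identity.
Qed.

Lemma regular_of_lower_bound (c : R) : 0 < c ->
  (forall u, c * rnorm u <= rnorm (u + Tlim (shifted u))) ->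
  regular_at (Frig R) 2 (form_sum (Frig R) (Hres R) J).
Proof.
move=> c0 low.
have ex (y : R) : exists T : L2 -> L2, 0 < y -> [/\ bounded_op T,
    graph_of T = sandwiched_resolvent (Frig R) (form_sum (Frig R) (Hres R) J) (2 +i* y) &
    forall k, T k + Tref y (shifted (T k)) = Tref y k].
  have [y0|y0] := ltP 0 y; last by exists id.
  by have [T Tb [TE Tk]] := sandwiched_exists y0; exists T.
have [T TP] := choice ex.
have [||T0 T0b T0c] := @perturbed_limit _ _ (@Tref R) (@Tlim R) shifted T c
  (@Tref_linear R) (@Tlim_bounded R) shifted_bounded (@Tref_cvg R) _ _ c0 low.
- by move=> y /TP[].
- by move=> y /TP[].
exists T0; split=> //; exists T; split=> //.
by move=> y /TP[].
Qed.
End OneDirection.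

Lemma Tlim_e1 : Tlim e1 = e1.
Proof.
have p0 : pts 0 = 1 by [].
have t0 : taill e1 = e0.
  by apply: l2P => n; rewrite taillE !basisE.
apply: l2P => -[|n].
  rewrite Tlim0 t0 (diag_basis (@pts_le1 R)) innerZl innerC inner_basis phiE phi_seq0.
  by rewrite !basisE mulr0 add0r rmorph0 mulr0.
rewrite TlimS FadE !basisE mul0r add0r; case: n => [|n]; last by rewrite !mulr0.
by rewrite /pts2 p0 expr1n !mulr1.
Qed.

Lemma Tlim_at1 (k : L2) : Tlim k 1%N = k 1%N.
Proof.
have p0 : pts 0 = 1 by [].
by rewrite TlimS FadE phiE phi_seq0 mulr0 add0r /pts2 p0 expr1n !mul1r.
Qed.

Lemma Tlim_e0_at0 : Tlim e0 0%N = 0 +i* pi.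
Proof.
have t0 : taill e0 = 0 by apply: l2P => n; rewrite taillE basisE.
by rewrite Tlim0 t0 (lin0 (diag_linear (@pts_le1 R))) inner0l addr0 basisE mulr1.
Qed.

(** The imaginary part of [Tlim] has rank one. *)
Lemma Tlim_im (x : L2) : im '[Tlim x, x] = pi * cmod (x 0%N) ^+ 2.
Proof.
have dl := diag_linear (@pts_le1 R).
rewrite -{2}(consl_taill x) TlimE consl_inner Fad_def (linD dl) (linZ dl) innerDl innerZl.
rewrite (diag_sym (@pts_le1 R) phi) (innerC phi).
have im0 : im '[diag pts (diag (@pts2 R) (taill x)), taill x] = 0.
  have p3 n : `|pts n * pts2 R n| <= 1.
    by rewrite normrM mulr_ile1 ?pts_le1 ?pts2_le1.
  rewrite (diag_comp _ (@pts_le1 R) (@pts2_le1 R)).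
  exact: (sym_real (diag_sym p3)).
move: ('[_, phi]) (x 0%N) ('[diag _ _, taill x]) im0 => [a b] [c d] [e f] /= ->.
by rewrite cmod_sqr /=; ring.
Qed.

(** The direction exchanging the first two coordinates. *)
Definition Vdir (k : L2) : L2 := k 0%N *: e1 + k 1%N *: e0.

Lemma Vdir_le (k : L2) : rnorm (Vdir k) <= 2 * rnorm k.
Proof.
have b n m : rnorm (k n *: basis R m) <= rnorm k.
  rewrite -lecR -normr_rnorm normrZ [`|basis R m|]normr_rnorm basis_rnorm mulr1.
  by rewrite normr_cmod lecR ell2_coord_le.
by rewrite (le_trans (rnormD _ _)) // (_ : 2 = 1 + 1) // mulrDl mul1r lerD.
Qed.

Lemma Vdir_bounded_sa : bounded_sa Vdir.
Proof.
split.
  apply/bounded_opP; split.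
    by move=> a k l; rewrite /Vdir !l2_addE !l2_scaleE !scalerDl !scalerDr !scalerA addrACA.
  by exists 2 => //; exact: Vdir_le.
move=> x y; rewrite /Vdir innerDl innerDr !innerZl !innerZr !inner_basis.
by rewrite !(innerC (basis R _) y) !inner_basis addrC mulrC [X in _ + X]mulrC.
Qed.

Lemma Vdir0 (k : L2) : Vdir k 0%N = k 1%N.
Proof. by rewrite l2_addE !l2_scaleE !basisE mulr0 mulr1 add0r. Qed.

End Perturbation.

(** * Regularity near the direction *)

Section LowerBound.
Variable R : realType.
Local Notation L2 := (l2 R).
Local Notation e0 := (basis R 0).
Local Notation e1 := (basis R 1).

(** The elementary inequality behind the lower bound: either [g >= N / 3], or
    [K * b >= N / 3] and [b ^+ 2 <= g * N] bounds [g] below. *)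
Lemma quadratic_lower_bound (N g b K : R) : 0 <= N -> 0 <= g -> 0 <= b -> 0 < K ->
  2 / 3 * N <= g + K * b -> b ^+ 2 <= g * N -> Num.min (1 / 3) (9 * K ^+ 2)^-1 * N <= g.
Proof.
move=> N0 g0 b0 K0 h1 h2; have [h|h] := leP (N / 3) g.
  rewrite (le_trans _ h) // [leRHS]mulrC ler_wpM2r // ge_min.
  by apply/orP; left; lra.
have Np : 0 < N by lra.
have K2 : 0 < 9 * K ^+ 2 by rewrite mulr_gt0 // exprn_gt0.
rewrite (@le_trans _ _ ((9 * K ^+ 2)^-1 * N)) //.
  by rewrite ler_wpM2r // ge_min lexx orbT.
rewrite ler_pdivrMl // -(ler_pM2r Np).
have h3 : N / 3 <= K * b by lra.
have h4 : (N / 3) ^+ 2 <= (K * b) ^+ 2.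
  by apply: lerXn2r; rewrite ?nnegrE ?mulr_ge0 ?divr_ge0 // ltW.
have h5 : K ^+ 2 * b ^+ 2 <= K ^+ 2 * (g * N) by rewrite ler_wpM2l ?sqr_ge0.
rewrite -exprMn in h5; have := le_trans h4 h5; lra.
Qed.

(** If [1 + Tlim (J - Jreg)] almost kills [u], then [<Tlim x, x>] is almost
    real for [x = (J - Jreg) u], so that [x 0] is small since the imaginary part
    of [Tlim] is [pi] times the projection to [e0]. As [x 0] is nearly
    [h * u 1], also [u 1], [x] and finally [u] are small. *)
Lemma lower_bound : exists2 eps : R, 0 < eps & forall (h : R) (J : L2 -> L2),
  h != 0 -> `|h| < eps -> bounded_sa J ->
  (forall x, rnorm (J x - h%:C *: Vdir x) <= eps * `|h| * rnorm x) ->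
  exists2 c : R, 0 < c & forall u, c * rnorm u <= rnorm (u + Tlim (shifted J u)).
Proof.
have /bounded_opP[Tl [M M0 bM]] := @Tlim_bounded R.
pose B := M + 1; have B0 : 0 < B by rewrite ltr_wpDl.
have B1 : 1 <= B by rewrite lerDr.
pose eps := (12 * B)^-1; have eps0 : 0 < eps by rewrite invr_gt0 mulr_gt0.
have Be : B * eps = 12^-1 by rewrite /eps invfM mulrCA divff ?mulr1 // gt_eqF.
exists eps => // h J h0 he Jsa Jh.
have eta0 : 0 < `|h| by rewrite normr_gt0.
pose K := B / `|h|; have K0 : 0 < K by rewrite divr_gt0.
exists (Num.min (1 / 3) (9 * K ^+ 2)^-1).
  by rewrite lt_min; apply/andP; split; [lra|rewrite invr_gt0 mulr_gt0 // exprn_gt0].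
move=> u; set x := shifted J u; set g := u + Tlim x.
have n0 : 0 <= rnorm u by exact: rnorm_ge0.
have eps1 : eps <= 12^-1 by rewrite -Be ler_peMl // ltW.
have Ju : rnorm (J u) <= 3 * `|h| * rnorm u.
  have -> : J u = (J u - h%:C *: Vdir u) + h%:C *: Vdir u by rewrite subrK.
  rewrite (le_trans (rnormD _ _)) // (le_trans (lerD (Jh u) (lexx _))) // rnormZr.
  rewrite (le_trans (lerD (lexx _) (ler_wpM2l (normr_ge0 h) (Vdir_le u)))) //.
  have := mulr_ge0 (normr_ge0 h) n0; move: (`|h|) (rnorm u) eps1 => a n; nra.
have Jr : rnorm (Jreg u) = cmod (u 1%N).
  apply: complexI; rewrite -normr_rnorm normrZ normr_cmod.
  by rewrite [`|e1|]normr_rnorm basis_rnorm mulr1.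
have xu : rnorm x <= 3 * `|h| * rnorm u + cmod (u 1%N).
  by rewrite (le_trans (rnormB _ _)) // Jr lerD.
have x0 : x 0%N = J u 0%N.
  by rewrite l2_subE /Jreg l2_scaleE basisE mulr0 subr0.
have ha : `|h| * cmod (u 1%N) <= cmod (x 0%N) + eps * `|h| * rnorm u.
  have -> : `|h| * cmod (u 1%N) = cmod (x 0%N - (J u - h%:C *: Vdir u) 0%N).
    by rewrite x0 l2_subE l2_scaleE Vdir0 opprB addrC subrK cmodM cmodR.
  rewrite (le_trans (cmodD _ _)) // cmodN lerD // (le_trans _ (Jh u)) //.
  exact: ell2_coord_le.
have ug : rnorm u <= rnorm g + B * rnorm x.
  have {1}-> : u = g - Tlim x by rewrite /g addrK.
  rewrite (le_trans (rnormB _ _)) // lerD // (le_trans (bM _)) //.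
  by rewrite ler_wpM2r ?rnorm_ge0 // lerDl.
have u1 : cmod (u 1%N) <= rnorm u by exact: ell2_coord_le.
have gx : pi * cmod (x 0%N) ^+ 2 <= rnorm g * rnorm x.
  have ux : im '[u, x] = 0.
    have sh (v w : L2) : '[shifted J v, w] = '[v, shifted J w].
      by rewrite innerBl innerBr Jreg_sym (Jsa).2.
    rewrite innerC imJ (sym_real sh); exact: oppr0.
  rewrite -Tlim_im (le_trans _ (cauchy_schwarz g x)) // (le_trans _ (normr_im_le _)) //.
  by rewrite /g innerDl imD ux add0r ler_norm.
move: xu ha ug u1 gx n0 eps1 he; rewrite -/B.
have := rnorm_ge0 g; have := cmod_ge0 (x 0%N); have := cmod_ge0 (u 1%N).
have := rnorm_ge0 x; have pi2 := pi_ge2 R.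
move: (rnorm g) (rnorm x) (cmod (x 0%N)) (cmod (u 1%N)) (rnorm u) => c d b a n.
move=> d0 a0 b0 c0 xu ha ug u1 gx n0 eps1 he.
apply: (@quadratic_lower_bound n c b K) => //.
  have h1 : a <= b / `|h| + eps * n.
    rewrite -(ler_pM2l eta0) mulrDr mulrCA divff ?gt_eqF // mulr1.
    by rewrite (le_trans ha) // lerD2l mulrA [eps * _]mulrC.
  have h2 : B * d <= B * (3 * `|h| * n + (b / `|h| + eps * n)).
    by rewrite ler_wpM2l ?(ltW B0) // (le_trans xu) // lerD2l.
  have h3 : B * (3 * `|h| * n) <= 3 * (B * eps) * n.
    rewrite !mulrA ler_wpM2r // [3 * B]mulrC -!mulrA ler_wpM2l ?(ltW B0) //.
    by rewrite ler_wpM2l // ltW.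
  have h4 : B * (eps * n) = 12^-1 * n by rewrite mulrA Be.
  have h5 : B * (b / `|h|) = K * b by rewrite /K mulrCA mulrC.
  rewrite Be in h3; rewrite !mulrDr h5 h4 in h2; lra.
have h1 : d <= 2 * n.
  rewrite (le_trans xu) // (_ : 2 * n = n + n); last by ring.
  by apply: lerD => //; rewrite -[leRHS]mul1r ler_wpM2r //; lra.
have h2 : 2 * b ^+ 2 <= pi * b ^+ 2 by rewrite ler_wpM2r ?sqr_ge0.
have h3 : c * d <= c * (2 * n) by rewrite ler_wpM2l.
lra.
Qed.
End LowerBound.

(** * Transversality and order *)

Section Conclusion.
Variable R : realType.
Local Notation L2 := (l2 R).
Local Notation e0 := (basis R 0).
Local Notation e1 := (basis R 1).
Local Notation F := (Frig R).
Local Notation H0 := (Hres R).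
Local Notation V := (@Vdir R).

Lemma regular_near : exists2 eps : R, 0 < eps & forall (h : R) (J : L2 -> L2),
  h != 0 -> `|h| < eps -> bounded_sa J ->
  (forall x, rnorm (J x - h%:C *: V x) <= eps * `|h| * rnorm x) ->
  regular_at F 2 (form_sum F H0 J).
Proof.
have [eps eps0 low] := lower_bound R; exists eps => // h J h0 he Jsa Jh.
have [c c0 cP] := low h J h0 he Jsa Jh.
exact: (regular_of_lower_bound Jsa c0).
Qed.

Lemma Vdir_scale_bounded_sa (r : R) : bounded_sa (fun x => r%:C *: V x).
Proof.
have [/bounded_opP[Vl [M M0 bM]] Vs] := Vdir_bounded_sa R; split.
  apply/bounded_opP; split.
    by move=> a x y; rewrite Vl scalerDr !scalerA [_ * a]mulrC.
  exists (`|r| * M); first exact: mulr_ge0.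
  by move=> x; rewrite rnormZr -mulrA ler_wpM2l.
by move=> x y; rewrite innerZl innerZr conjc_real Vs.
Qed.

Lemma regular_V : exists2 r : R, r != 0 & regular_at F 2 (path_along F H0 V r).
Proof.
have [eps eps0 reg] := regular_near.
have r0 : 0 < eps / 2 by rewrite divr_gt0.
exists (eps / 2); first by rewrite gt_eqF.
apply: (reg (eps / 2)); rewrite ?gt_eqF // ?gtr0_norm //.
- by rewrite ltr_pdivrMr // ltr_pMr // ltr1n.
- exact: Vdir_scale_bounded_sa.
- by move=> x; rewrite subrr rnorm0 !mulr_ge0 ?rnorm_ge0 // ltW.
Qed.

Lemma form_sum0 : form_sum F H0 (fun=> 0) = H0.
Proof.
rewrite form_sumE /Hres; congr graph_of; apply/funext => x.
by rewrite (lin0 (@Fad_linear R)) addr0.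
Qed.

Lemma zero_bounded_sa : bounded_sa (fun _ : L2 => 0 : L2).
Proof.
split; last by move=> x y; rewrite inner0l inner0r.
apply/bounded_opP; split; first by move=> a x y; rewrite scaler0 addr0.
by exists 0 => // x; rewrite rnorm0 mul0r.
Qed.

(** The range of the rigging is dense. *)
Lemma orth_ran (v : L2) : (forall x, '[v, Fop x] = 0) -> v = 0.
Proof.
move=> h; apply: rnorm0_eq0; apply/eqP; rewrite eq_le rnorm_ge0 andbT.
apply/ler_addgt0Pr => e e0; rewrite add0r leNgt; apply/negP => ve.
have v0 : 0 < rnorm v := lt_trans e0 ve.
have [] := @Fop_dense R [set w | rnorm (v - w) < e].
- by exists v; rewrite /= subrr rnorm0.
- rewrite openE => w /= vw; apply/rnorm_nbhsP.
  exists (e - rnorm (v - w)); first by rewrite subr_gt0.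
  move=> t wt; rewrite /= (_ : v - t = (v - w) + (w - t)); last by rewrite addrA subrK.
  by rewrite (le_lt_trans (rnormD _ _)) // -ltrBrDl.
move=> w [/= vw [x xw]].
have : rnorm v ^+ 2 <= rnorm v * rnorm (v - w).
  have wE : w = Fop x := xw.
  have -> : rnorm v ^+ 2 = re '[v, v - w] by rewrite innerBr wE h subr0 inner_rnorm.
  by rewrite (le_trans _ (cauchy_schwarz _ _)) // (le_trans _ (normr_re_le _)) // ler_norm.
by rewrite expr2 ler_pM2l // leNgt (lt_trans vw).
Qed.

Lemma form_sum_zero (J : L2 -> L2) : bounded_sa J -> form_sum F H0 J = H0 -> forall x, J x = 0.
Proof.
move=> Jsa; rewrite form_sumE /Hres => E.
have JF x : J (Fop x) = 0.
  apply: orth_ran => z; rewrite innerC Fop_adj.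
  have h : graph_of (diag (@res_entries R)) (x, diag (@res_entries R) x + Fad (J (Fop x))).
    by rewrite -E.
  have {}h : diag (@res_entries R) x + Fad (J (Fop x)) = diag (@res_entries R) x := h.
  have -> : Fad (J (Fop x)) = 0 by apply: (addrI (diag (@res_entries R) x)); rewrite addr0.
  by rewrite inner0r; exact: conjc0.
by move=> y; apply: orth_ran => x; rewrite (Jsa).2 JF inner0r.
Qed.

(** A path [Js] through [Hres] has [Js s0 = 0], so that derivative [V] brings
    [Js (s0 + h)] within [eps * h] of [h V] for small [h > 0]. *)
Lemma transversal_V : transversal_direction F H0 2 V.
Proof.
move=> [a [b [s0 [Js [/andP[as0 s0b] [Jsa _] res J0 dJ]]]]].
have [eps eps0 reg] := regular_near.
have [d /= d0 dP] := dJ eps eps0.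
pose m := Num.min (Num.min d eps) (b - s0); pose h := m / 2.
have m0 : 0 < m by rewrite !lt_min d0 eps0 subr_gt0.
have h0 : 0 < h by rewrite divr_gt0.
have : h < m by rewrite ltr_pdivrMr // ltr_pMr // ltr1n.
rewrite !lt_min => /andP[/andP[hd he] hb].
have hs : a < s0 + h < b by rewrite (lt_trans as0) ?ltrDl //= -ltrBrDl.
have [_] := res _ hs; apply; apply: (reg h) => //; rewrite ?gt_eqF ?gtr0_norm //.
  exact: Jsa.
move=> x; have := dP h; rewrite /= sub0r normrN gtr0_norm // gt_eqF // => /(_ hd isT x).
rewrite (form_sum_zero (Jsa _ (introT andP (conj as0 s0b))) J0) subr0.
rewrite !normr_rnorm -rmorphM lecR => le_e.
have -> : Js (s0 + h) x - h%:C *: V x = h%:C *: ((h^-1)%:C *: Js (s0 + h) x - V x).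
  by rewrite scalerBr scalerA -rmorphM divff ?gt_eqF // scale1r.
rewrite rnormZr gtr0_norm // [eps * h]mulrC -[leRHS]mulrA.
by apply: ler_wpM2l => //; exact: ltW.
Qed.

Section Order.
Variables (r : R) (T : L2 -> L2).
Hypothesis T_lim : is_boundary_value F (path_along F H0 V r) 2 T.

(** The operator [1 - r T V] whose generalized kernel consists of the resonance
    vectors. *)
Let A (u : L2) : L2 := u - r%:C *: T (V u).

Let T_eq k : T k + Tlim (r%:C *: V (T k) - Jreg (T k)) = Tlim k.
Proof. exact: (boundary_identity (Vdir_scale_bounded_sa r) T_lim). Qed.

(** At [r = 0] the limit identity fails in coordinate 1. *)
Lemma boundary_r_neq0 : r != 0.
Proof.
apply/eqP => r0; have := T_eq e1; rewrite r0 scale0r sub0r Tlim_e1 => h.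
have : (T e1 + Tlim (- Jreg (T e1))) 1%N = 1 by rewrite h basisE.
rewrite l2_addE Tlim_at1 l2_oppE /Jreg l2_scaleE basisE mulr1 subrr => /eqP.
by rewrite eq_sym oner_eq0.
Qed.

Lemma A_step (u v : L2) : v = A u ->
  [/\ v 0%N = 0, r%:C * Tlim e0 0%N * v 1%N = u 0%N &
      v = u - u 1%N *: e1 + v 1%N *: e1 - (r%:C * v 1%N) *: Tlim e0].
Proof.
move=> vA; have /bounded_opP[Tll _] := @Tlim_bounded R.
have [/bounded_opP[Vl _] _] := Vdir_bounded_sa R.
have rc : r%:C != 0 by rewrite (inj_eq (@complexI R) _ 0) boundary_r_neq0.
pose P (x : L2) := r%:C *: V x - Jreg x.
have PB x y : P (x - y) = P x - P y.
  rewrite /P (linB Vl) (linB (@Jreg_linear R)) scalerBr !opprD !opprK !addrA.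
  by rewrite [LHS](ACl (1*3*2*4))%AC.
have PZ a x : P (a *: x) = a *: P x.
  by rewrite /P (linZ Vl) (linZ (@Jreg_linear R)) scalerBr !scalerA [_ * a]mulrC.
have Tlim_P x : Tlim (P x) = (r%:C * x 0%N) *: e1 + (r%:C * x 1%N) *: Tlim e0 - x 1%N *: e1.
  rewrite /P /Vdir /Jreg (linB Tll) (linZ Tll) (linD Tll) !(linZ Tll) Tlim_e1.
  by rewrite scalerDr !scalerA.
have key : v + ((r%:C * v 0%N) *: e1 + (r%:C * v 1%N) *: Tlim e0 - v 1%N *: e1)
    = u - u 1%N *: e1.
  rewrite -Tlim_P vA /A PB (linB Tll) PZ (linZ Tll).
  rewrite addrACA -opprD -scalerDr T_eq Tlim_P /Vdir (linD Tll) !(linZ Tll) Tlim_e1.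
  rewrite scalerDr !scalerA !addrA; move: (_ *: e1) (_ *: Tlim e0) (u 1%N *: e1) => p q s.
  by rewrite opprD !addrA [LHS](ACl (1*4*(2*5)*(3*6)))%AC /= !subrr !addr0.
have v0 : v 0%N = 0.
  have : (v + ((r%:C * v 0%N) *: e1 + (r%:C * v 1%N) *: Tlim e0 - v 1%N *: e1)) 1%N = 0.
    by rewrite key l2_subE l2_scaleE basisE mulr1 subrr.
  rewrite l2_addE l2_subE l2_addE !l2_scaleE Tlim_at1 !basisE mulr0 !mulr1 addr0.
  by rewrite addrC subrK => /eqP; rewrite mulf_eq0 (negPf rc) /= => /eqP.
split=> //.
  have : (v + ((r%:C * v 0%N) *: e1 + (r%:C * v 1%N) *: Tlim e0 - v 1%N *: e1)) 0%N = u 0%N.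
    by rewrite key l2_subE l2_scaleE basisE mulr0 subr0.
  rewrite l2_addE l2_subE l2_addE !l2_scaleE !basisE v0 !mulr0 subr0 !add0r => <-.
  by rewrite mulrAC.
rewrite -key v0 mulr0 scale0r add0r.
move: (_ *: Tlim e0) (v 1%N *: e1) => p q.
by rewrite !addrA subrK addrK.
Qed.
Let rt_neq0 : r%:C * Tlim e0 0%N != 0.
Proof.
rewrite mulf_neq0 ?(inj_eq (@complexI R) _ 0) ?boundary_r_neq0 // Tlim_e0_at0.
by rewrite eq_complex /= eqxx /= gt_eqF // pi_gt0.
Qed.

Lemma A_stable u : A (A (A u)) = A (A u).
Proof.
have [v0 _ _] := A_step (erefl (A u)).
have [w0 w1 _] := A_step (erefl (A (A u))).
have [_ z1 ->] := A_step (erefl (A (A (A u)))).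
move: w1 z1; rewrite v0 w0 => /eqP; rewrite mulf_eq0 (negPf rt_neq0) /= => /eqP ->.
move=> /eqP; rewrite mulf_eq0 (negPf rt_neq0) /= => /eqP ->.
by rewrite mulr0 !scale0r !subr0 addr0.
Qed.

Lemma A_order2 : A (Tlim e0) != 0 /\ A (A (Tlim e0)) = 0.
Proof.
have [v0 v1 vE] := A_step (erefl (A (Tlim e0))).
have [w0 w1 wE] := A_step (erefl (A (A (Tlim e0)))).
have t0 : Tlim e0 0%N != 0 by move: rt_neq0; rewrite mulf_eq0 negb_or => /andP[].
have rv1 : r%:C * A (Tlim e0) 1%N = 1.
  by apply: (mulfI t0); rewrite mulr1 -[RHS]v1 mulrA [_ * r%:C]mulrC.
have {}vE : A (Tlim e0) = A (Tlim e0) 1%N *: e1.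
  rewrite {1}vE rv1 Tlim_at1 basisE scale0r subr0 scale1r addrC.
  by rewrite addrA addNr add0r.
split.
  apply: contraTneq (oner_neq0 R[i]) => v_0.
  by rewrite -rv1 v_0 l2_0E mulr0 eqxx.
have w10 : A (A (Tlim e0)) 1%N = 0.
  by move/eqP: w1; rewrite v0 mulf_eq0 (negPf rt_neq0) /= => /eqP.
by rewrite wE w10 mulr0 !scale0r subr0 addr0 -vE subrr.
Qed.

Lemma order_le2 k u : iter k A u = 0 -> iter k.-1 A u != 0 -> (k <= 2)%N.
Proof.
case: k => [|[|[|k]]] //= h; rewrite A_stable in h.
by rewrite h eqxx.
Qed.
End Order.

Lemma Vdir_order : direction_order F H0 2 V 2.
Proof.
split; last first.
  by move=> k u [_ [r [T [Tlim_T /= [h1 h2]]]]]; exact: order_le2 Tlim_T _ _ h1 h2.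
have [r _ [T TP]] := regular_V; exists (Tlim e0); split=> //.
by exists r, T; split=> //=; have [] := A_order2 TP.
Qed.

Lemma Hres_resonant : resonance_set F H0 2 H0.
Proof.
split; first by exists (fun=> 0); [exact: zero_bounded_sa|rewrite form_sum0].
move=> [T TP].
have E : path_along F H0 V 0 = H0.
  by rewrite -[RHS]form_sum0 /path_along; congr form_sum; apply/funext => x; rewrite scale0r.
by have := @boundary_r_neq0 0 T; rewrite E => /(_ TP); rewrite eqxx.
Qed.
End Conclusion.

Theorem proposition3p7 (R : realType) :
  exists (H K : hilbertType R) (F : set (H * K)) (H0 : set (H * H))
         (lam : R) (J : K -> K),
    rigging F /\
    self_adjoint H0 /\
    rel_compact (op_sqrt (op_abs H0)) F /\
    semi_regular F H0 lam /\
    essential_spectrum H0 (lam%:C)%C /\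
    resonance_set F H0 lam H0 /\
    regular_direction F H0 lam J /\
    transversal_direction F H0 lam J /\
    (exists d : nat, direction_order F H0 lam J d /\ (2 <= d)%N).
Proof.
exists (l2 R), (l2 R), (Frig R), (Hres R), 2, (@Vdir R).
have [r _ reg] := regular_V R.
split; first exact: Frig_rigging.
split; first exact: Hres_self_adjoint.
split; first exact: Frig_compact.
split.
  exists (path_along (Frig R) (Hres R) (@Vdir R) r) => //.
  by exists (fun x => r%:C *: Vdir x); first exact: Vdir_scale_bounded_sa.
split; first exact: Hres_essential.
split; first exact: Hres_resonant.
split; first by split; [exact: Vdir_bounded_sa|exists r].
split; first exact: transversal_V.
by exists 2%N; split=> //; exact: Vdir_order.
Qed.
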